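(* Let $R$ be an associative commutative unital ring, and let $\mathcal{C}$ be an $R$-linear triangulated category endowed with a bounded weight structure $w$. I. All virtual $t$-truncations (with respect to $w$) of functors of $R$-finite type (from $\mathcal{C}$) are of $R$-finite type also. II. Assume in addition that $\mathcal{C}$ is $R$-saturated. Then the following statements are valid. 1. For any $i\in\mathbb{Z}$ and $M\in\mathrm{Obj}\,\mathcal{C}$ the functors $\tau^{\le -i}(H_M)$ and $\tau^{\ge -i}(H_M)$ are representable, where $H_M=\mathcal{C}(-,M)$. 2. There exists a $t$-structure $t$ on $\mathcal{C}$ right adjacent to $w$. 3. The heart $\underline{Ht}$ of this $t$ naturally embeds (via $N\mapsto \mathcal{C}(-,N)|_{\underline{Hw}}$) into the category $\mathrm{AddFun}_R(\underline{Hw}^{op},R\text{-}\mathrm{mod})$. This embedding is essentially surjective whenever $R$ is noetherian.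
   Context: Weight structures: a pair $(\mathcal{C}_{w\le 0},\mathcal{C}_{w\ge 0})$ of classes of objects such that: (i) both are closed under retracts in $\mathcal{C}$; (ii) $\mathcal{C}_{w\le 0}\subset \mathcal{C}_{w\le 0}[1]$ and $\mathcal{C}_{w\ge 0}[1]\subset \mathcal{C}_{w\ge 0}$; (iii) $\mathcal{C}(X,Y)=0$ for $X\in\mathcal{C}_{w\le 0}$, $Y\in \mathcal{C}_{w\ge 0}[1]$; (iv) every object $M$ fits in a distinguished triangle $LM\to M\to RM\to LM[1]$ with $LM\in\mathcal{C}_{w\le 0}$, $RM\in \mathcal{C}_{w\ge 0}[1]$. Put $\mathcal{C}_{w\le i}=\mathcal{C}_{w\le 0}[i]$, $\mathcal{C}_{w\ge i}=\mathcal{C}_{w\ge 0}[i]$. The heart $\underline{Hw}$ is the full subcategory on $\mathcal{C}_{w\le 0}\cap\mathcal{C}_{w\ge 0}$. $w$ is bounded if $\bigcup_{i}\mathcal{C}_{w\le i}=\mathrm{Obj}\,\mathcal{C}=\bigcup_i\mathcal{C}_{w\ge i}$. A $t$-structure $t$ (cohomological convention) is right adjacent to $w$ if $\mathcal{C}^{t\le 0}=\mathcal{C}_{w\ge 0}$. For $m\in\mathbb{Z}$ choose distinguished triangles $w_{\le m}M\to M\to w_{\ge m+1}M\to$ with $w_{\le m}M\in\mathcal{C}_{w\le m}$, $w_{\ge m+1}M\in\mathcal{C}_{w\ge m+1}$; for $m<n$ there are unique morphisms of such triangles over $\mathrm{id}_M$ from the $m$-th one to the $n$-th one, giving $w_{\le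 m}M\to w_{\le n}M$ and $w_{\ge m+1}M\to w_{\ge n+1}M$. For a cohomological functor $H$ from $\mathcal{C}$ into an abelian category, the virtual $t$-truncations are the cohomological functors $\tau^{\ge -n}(H)(M)=\mathrm{Im}(H(w_{\le n+1}M)\to H(w_{\le n}M))$ and $\tau^{\le -n}(H)(M)=\mathrm{Im}(H(w_{\ge n}M)\to H(w_{\ge n-1}M))$, $n\in\mathbb{Z}$ (they do not depend on choices). An $R$-linear cohomological functor $H$ from $\mathcal{C}$ into $R$-modules is of $R$-finite type if for every $M\in\mathrm{Obj}\,\mathcal{C}$ the $R$-module $H(M)$ is finitely generated and $H(M[i])=0$ for almost all $i\in\mathbb{Z}$. $\mathcal{C}$ is $R$-saturated if the representable functors from $\mathcal{C}$ are exactly all the functors of $R$-finite type. $\mathrm{AddFun}_R(C,D)$ is the category of $R$-linear functors from $C$ to $D$; $R\text{-}\mathrm{mod}$ is the category of finitely generated $R$-modules. ''Embeds'' means: via a fully faithful functor. *)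

(* Defs.v *)
From HB Require Import structures.
From mathcomp Require Import all_boot all_order all_algebra.
From mathcomp Require Import boolp.
From mathcomp Require Import zify.

Set Implicit Arguments.
Unset Strict Implicit.
Unset Printing Implicit Defensive.

Import Order.TTheory GRing.Theory Num.Theory.
Local Open Scope ring_scope.

(* Equality of objects is never used: the shift is an autoequivalence with a *)
(* chosen quasi-inverse, and P[i] is the closure of {Y[i] | P Y} under       *)
(* isomorphism.                                                              *)

Definition fin_gen (R : pzRingType) (V : lmodType R) : Prop :=
  exists (n : nat) (v : 'I_n -> V),
    forall x : V, exists c : 'I_n -> R, x = \sum_(i < n) c i *: v i.

Lemma linear_ext (R : pzRingType) (U V : lmodType R) (f g : {linear U -> V}) :
  (forall x, f x = g x) -> f = g.
Proof.
case: f g => [f cf] [g cg] /= fg.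
have {}fg : f = g by exact: funext.
subst g; congr GRing.Linear.Pack.
case: cf cg => [[a] [b]] [[a'] [b']].
by rewrite (Prop_irrelevance a a') (Prop_irrelevance b b').
Qed.

Definition is_ideal (R : comPzRingType) (I : R -> Prop) : Prop :=
  [/\ I 0, forall x y, I x -> I y -> I (x + y) & forall a x, I x -> I (a * x)].

Definition noetherian (R : comPzRingType) : Prop :=
  forall I : R -> Prop, is_ideal I ->
  exists (n : nat) (g : 'I_n -> R), (forall i, I (g i)) /\
    forall x, I x -> exists c : 'I_n -> R, x = \sum_(i < n) c i * g i.

Section ImageModule.
Variables (R : pzRingType) (U V : lmodType R) (f : {linear U -> V}).

Definition im_pred : {pred V} := fun x => `[< exists y : U, x = f y >].

Lemma im_predP x : reflect (exists y : U, x = f y) (x \in im_pred).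
Proof. exact: asboolP. Qed.

Lemma im_pred_closed : GRing.submod_closed im_pred.
Proof.
split; first by apply/im_predP; exists 0; rewrite linear0.
move=> a x y /im_predP[x' ->] /im_predP[y' ->]; apply/im_predP.
by exists (a *: x' + y'); rewrite linearP.
Qed.

HB.instance Definition _ := GRing.isSubmodClosed.Build R V im_pred im_pred_closed.

Record im_type := ImType { im_val :> V; im_valP : im_val \in im_pred }.
HB.instance Definition _ := [isSub for im_val].
HB.instance Definition _ := [Choice of im_type by <:].
HB.instance Definition _ := [SubChoice_isSubLmodule of im_type by <:].

Lemma im_val_inj (x y : im_type) : im_val x = im_val y -> x = y.
Proof. exact: val_inj. Qed.

Lemma im_valD (x y : im_type) : im_val (x + y) = im_val x + im_val y.
Proof. by []. Qed.

Lemma im_valZ (a : R) (x : im_type) : im_val (a *: x) = a *: im_val x.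
Proof. by []. Qed.

End ImageModule.

Definition im_mod (R : pzRingType) (U V : lmodType R) (f : {linear U -> V}) :
  lmodType R := im_type f.

Record category := Category {
  cobj :> Type;
  chom : cobj -> cobj -> Type;
  cid1 : forall X, chom X X;
  ccomp : forall X Y Z, chom Y Z -> chom X Y -> chom X Z;
  ccompA : forall X Y Z T (h : chom Z T) (g : chom Y Z) (f : chom X Y),
    ccomp h (ccomp g f) = ccomp (ccomp h g) f;
  ccomp1f : forall X Y (f : chom X Y), ccomp (cid1 Y) f = f;
  ccompf1 : forall X Y (f : chom X Y), ccomp f (cid1 X) = f }.

Definition cisomorphic (K : category) (X Y : K) : Prop :=
  exists (f : chom X Y) (g : chom Y X),
    ccomp g f = cid1 X /\ ccomp f g = cid1 Y.

Record functor (K L : category) := Functor {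
  fobj :> K -> L;
  fmap : forall X Y : K, chom X Y -> chom (fobj X) (fobj Y);
  fmap1 : forall X, fmap (cid1 X) = cid1 (fobj X);
  fmapM : forall X Y Z (g : chom Y Z) (f : chom X Y),
    fmap (ccomp g f) = ccomp (fmap g) (fmap f) }.

Definition fully_faithful (K L : category) (F : functor K L) : Prop :=
  forall X Y : K, bijective (@fmap K L F X Y).

Definition ess_surj (K L : category) (F : functor K L) : Prop :=
  forall Y : L, exists X : K, cisomorphic (F X) Y.

Definition full_cat (K : category) (P : K -> Prop) : category :=
  @Category {X : K | P X} (fun X Y => chom (sval X) (sval Y))
    (fun X => cid1 (sval X))
    (fun X Y Z => @ccomp K (sval X) (sval Y) (sval Z))
    (fun X Y Z T => @ccompA K (sval X) (sval Y) (sval Z) (sval T))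
    (fun X Y => @ccomp1f K (sval X) (sval Y))
    (fun X Y => @ccompf1 K (sval X) (sval Y)).

Record lincat (R : comPzRingType) := LinCat {
  obj :> Type;
  mor : obj -> obj -> lmodType R;
  idm : forall X, mor X X;
  cmp : forall X Y Z, mor Y Z -> mor X Y -> mor X Z;
  cmpA : forall X Y Z T (h : mor Z T) (g : mor Y Z) (f : mor X Y),
    cmp h (cmp g f) = cmp (cmp h g) f;
  cmp1f : forall X Y (f : mor X Y), cmp (idm Y) f = f;
  cmpf1 : forall X Y (f : mor X Y), cmp f (idm X) = f;
  cmpPl : forall X Y Z (a : R) (g g' : mor Y Z) (f : mor X Y),
    cmp (a *: g + g') f = a *: cmp g f + cmp g' f;
  cmpPr : forall X Y Z (a : R) (g : mor Y Z) (f f' : mor X Y),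
    cmp g (a *: f + f') = a *: cmp g f + cmp g f' }.

Arguments idm {R l} X.
Notation "g \oc f" := (cmp g f) (at level 40, left associativity).

Section LinearCategories.
Variables (R : comPzRingType) (C : lincat R).
Implicit Types X Y Z : C.

Definition is_iso X Y (f : mor X Y) : Prop :=
  exists g : mor Y X, g \oc f = idm X /\ f \oc g = idm Y.

Definition isomorphic X Y : Prop := exists f : mor X Y, is_iso f.

Definition is_retract X Y : Prop :=
  exists (i : mor X Y) (p : mor Y X), p \oc i = idm X.

Definition is_zero X : Prop := idm X = 0.

Definition additive_cat : Prop :=
  (exists Z : C, is_zero Z) /\
  forall X Y, exists (Z : C) (i : mor X Z) (j : mor Y Z)
    (p : mor Z X) (q : mor Z Y),
    [/\ p \oc i = idm X, q \oc j = idm Y, q \oc i = 0, p \oc j = 0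
      & i \oc p + j \oc q = idm Z].

Definition cat_of : category :=
  @Category C (fun X Y => mor X Y) (fun X => idm X)
    (fun X Y Z g f => g \oc f) (@cmpA R C) (@cmp1f R C) (@cmpf1 R C).

Definition full_lincat (P : C -> Prop) : lincat R :=
  @LinCat R {X : C | P X} (fun A B => mor (sval A) (sval B))
    (fun A => idm (sval A))
    (fun A B D => @cmp R C (sval A) (sval B) (sval D))
    (fun A B D E => @cmpA R C (sval A) (sval B) (sval D) (sval E))
    (fun A B => @cmp1f R C (sval A) (sval B))
    (fun A B => @cmpf1 R C (sval A) (sval B))
    (fun A B D => @cmpPl R C (sval A) (sval B) (sval D))
    (fun A B D => @cmpPr R C (sval A) (sval B) (sval D)).

Lemma cmp0f X Y Z (f : mor X Y) : (0 : mor Y Z) \oc f = 0.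
Proof.
by move: (cmpPl 1 (0 : mor Y Z) 0 f); rewrite !scale1r addr0 -[LHS]addr0 =>
   /addrI.
Qed.

Lemma cmpf0 X Y Z (g : mor Y Z) : g \oc (0 : mor X Y) = 0.
Proof.
by move: (cmpPr 1 g (0 : mor X Y) 0); rewrite !scale1r addr0 -[LHS]addr0 =>
   /addrI.
Qed.

Lemma cmpNf X Y Z (g : mor Y Z) (f : mor X Y) : (- g) \oc f = - (g \oc f).
Proof. by move: (cmpPl (-1) g 0 f); rewrite cmp0f !addr0 !scaleN1r. Qed.

Lemma cmpfN X Y Z (g : mor Y Z) (f : mor X Y) : g \oc (- f) = - (g \oc f).
Proof. by move: (cmpPr (-1) g f 0); rewrite cmpf0 !addr0 !scaleN1r. Qed.

Lemma cmpBf X Y Z (g g' : mor Y Z) (f : mor X Y) :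
  (g - g') \oc f = g \oc f - g' \oc f.
Proof. by rewrite -cmpNf -[g in LHS]scale1r cmpPl scale1r. Qed.

Lemma cmpfB X Y Z (g : mor Y Z) (f f' : mor X Y) :
  g \oc (f - f') = g \oc f - g \oc f'.
Proof. by rewrite -cmpfN -[f in LHS]scale1r cmpPr scale1r. Qed.

Lemma zero_from X Y (f : mor X Y) : is_zero X -> f = 0.
Proof. by move=> X0; rewrite -[f]cmpf1 X0 cmpf0. Qed.

Lemma zero_to X Y (f : mor X Y) : is_zero Y -> f = 0.
Proof. by move=> Y0; rewrite -[f]cmp1f Y0 cmp0f. Qed.

Lemma iso_refl X : isomorphic X X.
Proof. by exists (idm X), (idm X); rewrite !cmp1f. Qed.

Lemma iso_sym X Y : isomorphic X Y -> isomorphic Y X.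
Proof. by case=> f [g [gf fg]]; exists g, f. Qed.

Lemma is_iso_comp X Y Z (g : mor Y Z) (f : mor X Y) :
  is_iso g -> is_iso f -> is_iso (g \oc f).
Proof.
move=> [g' [g'g gg']] [f' [f'f ff']]; exists (f' \oc g'); split.
  by rewrite cmpA -(cmpA f') g'g cmpf1.
by rewrite cmpA -(cmpA g) ff' cmpf1.
Qed.

Lemma iso_trans X Y Z : isomorphic X Y -> isomorphic Y Z -> isomorphic X Z.
Proof. by move=> [f If] [g Ig]; exists (g \oc f); exact: is_iso_comp. Qed.

End LinearCategories.

Record linfunctor (R : comPzRingType) (C D : lincat R) := LinFunctor {
  lobj :> C -> D;
  lmap : forall X Y : C, {linear mor X Y -> mor (lobj X) (lobj Y)};
  lmap1 : forall X, lmap X X (idm X) = idm (lobj X);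
  lmapM : forall X Y Z (g : mor Y Z) (f : mor X Y),
    lmap X Z (g \oc f) = lmap Y Z g \oc lmap X Y f }.

(* [S \o T] is naturally isomorphic to the identity *)
Definition comp_iso_id (R : comPzRingType) (C : lincat R)
    (S T : linfunctor C C) : Prop :=
  exists eta : forall X : C, mor X (S (T X)),
    (forall X, is_iso (eta X)) /\
    forall X Y (f : mor X Y),
      eta Y \oc f = lmap S _ _ (lmap T _ _ f) \oc eta X.

Section ModFunctors.
Variables (R : comPzRingType) (C : lincat R).

Record modfun := ModFun {
  mobj :> C -> lmodType R;
  mmap : forall X Y : C, mor X Y -> {linear mobj Y -> mobj X};
  mmap1 : forall X (x : mobj X), mmap (idm X) x = x;
  mmapM : forall X Y Z (g : mor Y Z) (f : mor X Y) (x : mobj Z),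
    mmap (g \oc f) x = mmap f (mmap g x);
  mmapP : forall X Y (a : R) (f g : mor X Y) (x : mobj Y),
    mmap (a *: f + g) x = a *: mmap f x + mmap g x }.

Record modnat (F G : modfun) := ModNat {
  ncomp :> forall X : C, {linear F X -> G X};
  ncomp_nat : forall X Y (f : mor X Y) (x : F Y),
    ncomp X (mmap F f x) = mmap G f (ncomp Y x) }.

Lemma modnat_ext (F G : modfun) (s t : modnat F G) :
  (forall X x, s X x = t X x) -> s = t.
Proof.
case: s t => [s sn] [t tn] /= st.
have {}st : s = t.
  by apply: functional_extensionality_dep => X; apply: linear_ext => x; exact: st.
by subst t; congr ModNat; exact: Prop_irrelevance.
Qed.

Lemma idn_nat (F : modfun) X Y (f : mor X Y) (x : F Y) :
  (idfun : {linear F X -> F X}) (mmap F f x) =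
  mmap F f ((idfun : {linear F Y -> F Y}) x).
Proof. by []. Qed.

Definition modnat_id (F : modfun) : modnat F F := ModNat (@idn_nat F).

Lemma compn_nat (F G H : modfun) (t : modnat G H) (s : modnat F G)
    X Y (f : mor X Y) (x : F Y) :
  (t X \o s X) (mmap F f x) = mmap H f ((t Y \o s Y) x).
Proof. by rewrite /= !ncomp_nat. Qed.

Definition modnat_comp (F G H : modfun) (t : modnat G H) (s : modnat F G) :
  modnat F H := @ModNat F H (fun X => (t X \o s X)) (@compn_nat F G H t s).

Lemma modnat_compA F G H K (u : modnat H K) (t : modnat G H) (s : modnat F G) :
  modnat_comp u (modnat_comp t s) = modnat_comp (modnat_comp u t) s.
Proof. exact: modnat_ext. Qed.

Lemma modnat_comp1f F G (s : modnat F G) : modnat_comp (modnat_id G) s = s.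
Proof. exact: modnat_ext. Qed.

Lemma modnat_compf1 F G (s : modnat F G) : modnat_comp s (modnat_id F) = s.
Proof. exact: modnat_ext. Qed.

Definition modfun_cat : category :=
  @Category modfun modnat modnat_id modnat_comp
    modnat_compA modnat_comp1f modnat_compf1.

(* AddFun_R(C^op, R-mod): contravariance is built into modfun, and R-mod is   *)
(* the category of finitely generated R-modules.                              *)
Definition AddFun : category :=
  @full_cat modfun_cat (fun F : modfun => forall X : C, fin_gen (F X)).

End ModFunctors.

Section ModFunctorConstructions.
Variables (R : comPzRingType) (C : lincat R).

Section Yoneda.
Variable M : C.

Definition precomp (X Y : C) (f : mor X Y) (x : mor Y M) : mor X M := x \oc f.

Lemma precomp_linear X Y (f : mor X Y) : linear (precomp f).
Proof. by move=> a x y; exact: cmpPl. Qed.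

HB.instance Definition _ X Y (f : mor X Y) :=
  GRing.isLinear.Build R (mor Y M) (mor X M) *:%R (precomp f)
    (precomp_linear f).

Lemma precomp1 X (x : mor X M) : precomp (idm X) x = x.
Proof. exact: cmpf1. Qed.

Lemma precompM X Y Z (g : mor Y Z) (f : mor X Y) (x : mor Z M) :
  precomp (g \oc f) x = precomp f (precomp g x).
Proof. exact: cmpA. Qed.

Lemma precompP X Y (a : R) (f g : mor X Y) (x : mor Y M) :
  precomp (a *: f + g) x = a *: precomp f x + precomp g x.
Proof. exact: cmpPr. Qed.

Definition yoneda : modfun C :=
  @ModFun R C (fun X => mor X M) (fun X Y f => precomp f)
    precomp1 precompM precompP.

End Yoneda.

Definition representable (F : modfun C) : Prop :=
  exists N : C, @cisomorphic (modfun_cat C) F (yoneda N).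

Definition postcomp (M N : C) (h : mor M N) (X : C) (x : mor X M) : mor X N := h \oc x.

Lemma postcomp_linear (M N : C) (h : mor M N) X : linear (@postcomp M N h X).
Proof. by move=> a x y; exact: cmpPr. Qed.

HB.instance Definition _ (M N : C) (h : mor M N) X :=
  GRing.isLinear.Build R (mor X M) (mor X N) *:%R (@postcomp M N h X)
    (@postcomp_linear M N h X).

Definition mrestrict (P : C -> Prop) (F : modfun C) : modfun (full_lincat P) :=
  @ModFun R (full_lincat P) (fun X => F (sval X))
    (fun X Y => @mmap R C F (sval X) (sval Y))
    (fun X => @mmap1 R C F (sval X))
    (fun X Y Z => @mmapM R C F (sval X) (sval Y) (sval Z))
    (fun X Y => @mmapP R C F (sval X) (sval Y)).

Section RestrictedYoneda.
Variables (P Q : C -> Prop).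
Hypothesis fg : forall X N, P X -> Q N -> fin_gen (mor X N).

Definition ryoneda_obj (N : full_lincat Q) : AddFun (full_lincat P) :=
  exist (fun F : modfun (full_lincat P) => forall X, fin_gen (F X))
    (mrestrict P (yoneda (sval N)))
    (fun X => fg (proj2_sig X) (proj2_sig N)).

Lemma ryoneda_nat (M N : full_lincat Q) (h : mor M N) (X Y : full_lincat P)
    (f : mor X Y) (x : mor (sval Y) (sval M)) :
  postcomp h (precomp f x) = precomp f (postcomp h x).
Proof. exact: cmpA. Qed.

Definition ryoneda_map (M N : full_lincat Q) (h : mor M N) :
    @chom (AddFun (full_lincat P)) (ryoneda_obj M) (ryoneda_obj N) :=
  @ModNat R (full_lincat P) (sval (ryoneda_obj M)) (sval (ryoneda_obj N))
    (fun X => @postcomp (sval M) (sval N) h (sval X)) (@ryoneda_nat M N h).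

Lemma ryoneda_map1 (M : full_lincat Q) :
  ryoneda_map (idm M) = @cid1 (AddFun (full_lincat P)) (ryoneda_obj M).
Proof. by apply: modnat_ext => X x; exact: cmp1f. Qed.

Lemma ryoneda_mapM (L M N : full_lincat Q) (g : mor M N) (f : mor L M) :
  ryoneda_map (g \oc f) =
  @ccomp (AddFun (full_lincat P)) _ _ _ (ryoneda_map g) (ryoneda_map f).
Proof. by apply: modnat_ext => X x; rewrite /=; exact/esym/cmpA. Qed.

(* N |-> C(-, N) restricted to P, for N in Q *)
Definition ryoneda :
    functor (cat_of (full_lincat Q)) (AddFun (full_lincat P)) :=
  @Functor (cat_of (full_lincat Q)) (AddFun (full_lincat P))
    ryoneda_obj ryoneda_map ryoneda_map1 ryoneda_mapM.

End RestrictedYoneda.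

(* Data for a functor M |-> Im(H (sB M) -> H (sA M)): the assignments sA and  *)
(* sB need only be functorial after composition with sc.                      *)
Record im_system := ImSystem {
  sA : C -> C;
  sB : C -> C;
  sc : forall M, mor (sA M) (sB M);
  sAmap : forall M N : C, mor M N -> mor (sA M) (sA N);
  sBmap : forall M N : C, mor M N -> mor (sB M) (sB N);
  sc_nat : forall (M N : C) (f : mor M N), sc N \oc sAmap f = sBmap f \oc sc M;
  sc1 : forall M, sc M \oc sAmap (idm M) = sc M;
  scM : forall (L M N : C) (g : mor M N) (f : mor L M),
    sc N \oc sAmap (g \oc f) = sc N \oc (sAmap g \oc sAmap f);
  scP : forall (M N : C) (a : R) (f g : mor M N),
    sc N \oc sAmap (a *: f + g) = sc N \oc (a *: sAmap f + sAmap g) }.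

Section ImageFunctor.
Variables (H : modfun C) (S : im_system).

Definition imf_obj (M : C) : lmodType R := im_mod (mmap H (sc S M)).

Lemma imf_map_proof (M N : C) (f : mor M N) (x : imf_obj N) :
  mmap H (sAmap S f) (im_val x) \in im_pred (mmap H (sc S M)).
Proof.
case: x => x /= /im_predP[y ->]; apply/im_predP.
by exists (mmap H (sBmap S f) y); rewrite -!mmapM sc_nat.
Qed.

Definition imf_map (M N : C) (f : mor M N) (x : imf_obj N) : imf_obj M :=
  ImType (imf_map_proof f x).

Lemma imf_map_linear (M N : C) (f : mor M N) : linear (imf_map f).
Proof. by move=> a x y; apply: val_inj; rewrite /= linearP. Qed.

HB.instance Definition _ (M N : C) (f : mor M N) :=
  GRing.isLinear.Build R (imf_obj N) (imf_obj M) *:%R (imf_map f)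
    (imf_map_linear f).

Lemma imf_map1 M (x : imf_obj M) : imf_map (idm M) x = x.
Proof.
apply: val_inj => /=; case: x => x /= /im_predP[y ->].
by rewrite -mmapM sc1.
Qed.

Lemma imf_mapM (L M N : C) (g : mor M N) (f : mor L M) (x : imf_obj N) :
  imf_map (g \oc f) x = imf_map f (imf_map g x).
Proof.
apply: val_inj => /=; case: x => x /= /im_predP[y ->].
by rewrite -!mmapM scM.
Qed.

Lemma imf_mapP (M N : C) (a : R) (f g : mor M N) (x : imf_obj N) :
  imf_map (a *: f + g) x = a *: imf_map f x + imf_map g x.
Proof.
apply: im_val_inj; rewrite im_valD im_valZ /=.
by case: x => x /= /im_predP[y ->]; rewrite -!mmapM scP mmapM mmapP !mmapM.
Qed.

Definition imfun : modfun C :=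
  @ModFun R C imf_obj (fun M N f => imf_map f) imf_map1 imf_mapM imf_mapP.

End ImageFunctor.
End ModFunctorConstructions.

Record tricat (R : comPzRingType) := TriCat {
  tcat :> lincat R;
  tri_additive : additive_cat tcat;
  sh : linfunctor tcat tcat;
  shi : linfunctor tcat tcat;
  sh_shi : comp_iso_id sh shi;
  shi_sh : comp_iso_id shi sh;
  dist : forall X Y Z : tcat, mor X Y -> mor Y Z -> mor Z (sh X) -> Prop;
  dist_iso : forall (X Y Z X' Y' Z' : tcat)
    (u : mor X Y) (v : mor Y Z) (w : mor Z (sh X))
    (u' : mor X' Y') (v' : mor Y' Z') (w' : mor Z' (sh X'))
    (f : mor X X') (g : mor Y Y') (h : mor Z Z'),
    is_iso f -> is_iso g -> is_iso h ->
    g \oc u = u' \oc f -> h \oc v = v' \oc g -> lmap sh _ _ f \oc w = w' \oc h ->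
    dist u v w -> dist u' v' w';
  dist_one : forall X Z : tcat, is_zero Z ->
    dist (idm X) (0 : mor X Z) (0 : mor Z (sh X));
  dist_cone : forall (X Y : tcat) (u : mor X Y),
    exists (Z : tcat) (v : mor Y Z) (w : mor Z (sh X)), dist u v w;
  dist_rot : forall (X Y Z : tcat) (u : mor X Y) (v : mor Y Z)
    (w : mor Z (sh X)), dist u v w <-> dist v w (- lmap sh _ _ u);
  dist_mor : forall (X Y Z X' Y' Z' : tcat)
    (u : mor X Y) (v : mor Y Z) (w : mor Z (sh X))
    (u' : mor X' Y') (v' : mor Y' Z') (w' : mor Z' (sh X'))
    (f : mor X X') (g : mor Y Y'),
    dist u v w -> dist u' v' w' -> g \oc u = u' \oc f ->
    exists h : mor Z Z', h \oc v = v' \oc g /\ lmap sh _ _ f \oc w = w' \oc h;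
  dist_octa : forall (X Y Z Z' X' Y' : tcat)
    (u : mor X Y) (v : mor Y Z)
    (j : mor Y Z') (k : mor Z' (sh X))
    (l : mor Z X') (i : mor X' (sh Y))
    (m : mor Z Y') (n : mor Y' (sh X)),
    dist u j k -> dist v l i -> dist (v \oc u) m n ->
    exists (f : mor Z' Y') (g : mor Y' X'),
      [/\ dist f g (lmap sh _ _ j \oc i), f \oc j = m \oc v, n \oc f = k,
          g \oc m = l & i \oc g = lmap sh _ _ u \oc n] }.

Notation "f '[1]'" := (lmap (sh _) _ _ f) (at level 2, format "f [1]").

(* M[i]; Negz n is - n.+1 *)
Definition shiftz (R : comPzRingType) (C : tricat R) (M : C) (i : int) : C :=
  match i with
  | Posz n => iter n (sh C) M
  | Negz n => iter n.+1 (shi C) M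
  end.

Definition shiftp (R : comPzRingType) (C : tricat R) (P : C -> Prop) (i : int)
    (X : C) : Prop :=
  exists Y : C, P Y /\ isomorphic X (shiftz Y i).

Section CohomologicalFunctors.
Variables (R : comPzRingType) (C : tricat R).

Definition cohomological (H : modfun C) : Prop :=
  forall (X Y Z : C) (u : mor X Y) (v : mor Y Z) (w : mor Z (sh C X)),
    dist u v w ->
    forall y : H Y, mmap H u y = 0 <-> exists z : H Z, y = mmap H v z.

Definition finite_type (H : modfun C) : Prop :=
  cohomological H /\
  forall M : C, fin_gen (H M) /\
    exists s : seq int, forall i : int, i \notin s ->
      forall x : H (shiftz M i), x = 0.

Definition saturated : Prop :=
  forall H : modfun C, representable H <-> finite_type H.

End CohomologicalFunctors.

Record weight_structure (R : comPzRingType) (C : tricat R) := WeightStr {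
  wle0 : C -> Prop;
  wge0 : C -> Prop;
  wle0_retract : forall X Y : C, is_retract X Y -> wle0 Y -> wle0 X;
  wge0_retract : forall X Y : C, is_retract X Y -> wge0 Y -> wge0 X;
  wle0_shift : forall X : C, wle0 X -> shiftp wle0 1 X;
  wge0_shift : forall X : C, shiftp wge0 1 X -> wge0 X;
  w_orth : forall (X Y : C), wle0 X -> shiftp wge0 1 Y ->
    forall f : mor X Y, f = 0;
  w_dec : forall M : C, exists (L N : C)
    (a : mor L M) (b : mor M N) (c : mor N (sh C L)),
    [/\ dist a b c, wle0 L & shiftp wge0 1 N] }.

Record t_structure (R : comPzRingType) (C : tricat R) := TStr {
  tle0 : C -> Prop;
  tge0 : C -> Prop;
  tle0_iso : forall X Y : C, isomorphic X Y -> tle0 Y -> tle0 X;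
  tge0_iso : forall X Y : C, isomorphic X Y -> tge0 Y -> tge0 X;
  tle0_shift : forall X : C, shiftp tle0 1 X -> tle0 X;
  tge0_shift : forall X : C, tge0 X -> shiftp tge0 1 X;
  t_orth : forall (X Y : C), shiftp tle0 1 X -> tge0 Y ->
    forall f : mor X Y, f = 0;
  t_dec : forall M : C, exists (L N : C)
    (a : mor L M) (b : mor M N) (c : mor N (sh C L)),
    [/\ dist a b c, tle0 L & shiftp tge0 (-1) N] }.

Section WeightDefs.
Variables (R : comPzRingType) (C : tricat R) (w : weight_structure C).

Definition wle (i : int) : C -> Prop := shiftp (wle0 w) i.
Definition wge (i : int) : C -> Prop := shiftp (wge0 w) i.

Definition w_heart (X : C) : Prop := wle0 w X /\ wge0 w X.

Definition w_bounded : Prop :=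
  forall M : C, (exists i, wle i M) /\ (exists i, wge i M).

Definition t_heart (t : t_structure C) (X : C) : Prop := tle0 t X /\ tge0 t X.

Definition right_adjacent (t : t_structure C) : Prop :=
  forall X : C, tle0 t X <-> wge0 w X.

(* w_{<= m} M -> M -> w_{>= m+1} M -> (w_{<= m} M)[1] *)
Record weight_dec (m : int) (M : C) := WeightDec {
  wdL : C;
  wdR : C;
  wda : mor wdL M;
  wdb : mor M wdR;
  wdc : mor wdR (sh C wdL);
  wd_dist : dist wda wdb wdc;
  wdL_le : wle m wdL;
  wdR_ge : wge (m + 1) wdR }.

Definition dec_mor m n (M N : C) (d : weight_dec m M) (e : weight_dec n N)
    (f : mor M N) (g : mor (wdL d) (wdL e)) (h : mor (wdR d) (wdR e)) : Prop :=
  [/\ f \oc wda d = wda e \oc g, h \oc wdb d = wdb e \oc f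
    & g[1] \oc wdc d = wdc e \oc h].

End WeightDefs.

Arguments dec_mor {R C w m n M N} d e f g h.

Section ShiftLemmas.
Variables (R : comPzRingType) (C : tricat R).
Implicit Types X Y Z T : C.

Lemma comp_iso_id_inj (S T : linfunctor C C) : comp_iso_id S T ->
  forall X Y (f g : mor X Y), lmap T _ _ f = lmap T _ _ g -> f = g.
Proof.
move=> [eta [eI en]] X Y f g fg; have [e' [e'e _]] := eI Y.
by rewrite -[f]cmp1f -[g]cmp1f -e'e -!cmpA !en fg.
Qed.

Lemma sh_inj X Y (f g : mor X Y) : f[1] = g[1] -> f = g.
Proof. exact: comp_iso_id_inj (shi_sh C) _ _ f g. Qed.

Lemma sh_full X Y (h : mor (sh C X) (sh C Y)) : exists f : mor X Y, f[1] = h.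
Proof.
have [eta [eI en]] := shi_sh C; have [e' [e'e ee']] := eI Y.
exists (e' \oc lmap (shi C) _ _ h \oc eta X).
apply: (comp_iso_id_inj (sh_shi C)).
have [d [de ed]] := eI X; rewrite -[LHS]cmpf1 -[RHS]cmpf1 -ed !cmpA; congr (_ \oc _).
by rewrite -en !cmpA ee' cmp1f.
Qed.

Lemma lin_is_iso (F : linfunctor C C) X Y (f : mor X Y) :
  is_iso f -> is_iso (lmap F _ _ f).
Proof.
by case=> g [gf fg]; exists (lmap F _ _ g); rewrite -!lmapM gf fg !lmap1.
Qed.

Lemma lin_iso (F : linfunctor C C) X Y : isomorphic X Y -> isomorphic (F X) (F Y).
Proof. by case=> f If; exists (lmap F _ _ f); exact: lin_is_iso. Qed.

Lemma sh_shi_iso X : isomorphic X (sh C (shi C X)).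
Proof. by have [e [eI _]] := sh_shi C; exists (e X). Qed.

Lemma shi_sh_iso X : isomorphic X (shi C (sh C X)).
Proof. by have [e [eI _]] := shi_sh C; exists (e X). Qed.

Lemma shiftz_iso X Y i : isomorphic X Y -> isomorphic (shiftz X i) (shiftz Y i).
Proof.
by move=> XY; case: i => n; (elim: n => [|n IH] //=; exact: lin_iso).
Qed.

Lemma shiftzS X i : isomorphic (sh C (shiftz X i)) (shiftz X (i + 1)).
Proof.
case: i => [n|[|n]].
- by rewrite -[Posz n + 1]/(Posz (n + 1)) addn1; exact: iso_refl.
- exact/iso_sym/sh_shi_iso.
- have ->: Negz n.+1 + 1 = Negz n by rewrite !NegzE; lia.
  exact/iso_sym/sh_shi_iso.
Qed.

Lemma mor0_iso X X' Y Y' : isomorphic X X' -> isomorphic Y Y' ->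
  (forall g : mor X' Y', g = 0) -> forall f : mor X Y, f = 0.
Proof.
move=> [a [a' [a'a _]]] [b [b' [b'b _]]] H f.
have -> : f = b' \oc (b \oc f \oc a') \oc a.
  by rewrite -!cmpA a'a cmpf1 cmpA b'b cmp1f.
by rewrite (H (b \oc f \oc a')) cmpf0 cmp0f.
Qed.

Lemma mor0_sh X Y : (forall g : mor (sh C X) (sh C Y), g = 0) <->
  (forall g : mor X Y, g = 0).
Proof.
split=> H g; first by apply: sh_inj; rewrite linear0; exact: H.
by have [f fg] := sh_full g; rewrite -fg (H f) linear0.
Qed.

Lemma is_zero_sh X : is_zero X -> is_zero (sh C X).
Proof. by rewrite /is_zero -lmap1 => ->; rewrite linear0. Qed.

Lemma shiftp_iso (P : C -> Prop) i X Y :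
  isomorphic X Y -> shiftp P i Y -> shiftp P i X.
Proof. by move=> XY [Z [PZ YZ]]; exists Z; split=> //; apply: iso_trans YZ. Qed.

Lemma shiftp_sh (P : C -> Prop) i X : shiftp P i X -> shiftp P (i + 1) (sh C X).
Proof.
move=> [Y [PY XY]]; exists Y; split=> //.
exact: iso_trans (lin_iso _ XY) (shiftzS _ _).
Qed.

Lemma shiftp_shV (P : C -> Prop) i X : shiftp P (i + 1) (sh C X) -> shiftp P i X.
Proof.
move=> [Y [PY XY]]; exists Y; split=> //.
apply: iso_trans (shi_sh_iso _) _.
apply: iso_trans (iso_sym (shi_sh_iso _)); apply: lin_iso.
exact: iso_trans XY (iso_sym (shiftzS _ _)).
Qed.

Lemma dist_lift X Y Z (u : mor X Y) (v : mor Y Z) (w : mor Z (sh C X))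
    T (f : mor T Y) : dist u v w -> v \oc f = 0 -> exists g, u \oc g = f.
Proof.
move=> uvw vf; have [[Z0 Z0z] _] := tri_additive C.
have /dist_rot D1 := dist_one T Z0z; have /dist_rot D2 := uvw.
have [|h [_ h2]] := dist_mor (f := f) (g := 0 : mor Z0 Z) D1 D2.
  by rewrite vf cmp0f.
have [g gh] := sh_full h; exists g; apply: sh_inj.
move: h2; rewrite lmap1 cmpfN cmpf1 cmpNf => /oppr_inj ->.
by rewrite -gh lmapM.
Qed.

Lemma dist_colift X Y Z (u : mor X Y) (v : mor Y Z) (w : mor Z (sh C X))
    T (f : mor Y T) : dist u v w -> f \oc u = 0 -> exists g, g \oc v = f.
Proof.
move=> uvw fu; have [[Z0 Z0z] _] := tri_additive C.
have D1 : dist (0 : mor Z0 T) (idm T) (0 : mor T (sh C Z0)).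
  apply/dist_rot; rewrite linear0 oppr0.
  have -> : (0 : mor (sh C Z0) (sh C T)) = 0 by [].
  exact/dist_one/is_zero_sh.
have [|h [h1 _]] := dist_mor (f := 0 : mor X Z0) (g := f) uvw D1.
  by rewrite fu cmpf0.
by exists h; rewrite h1 cmp1f.
Qed.

Lemma dist_sh X Y Z (u : mor X Y) (v : mor Y Z) (w : mor Z (sh C X)) :
  dist u v w <-> dist (u[1]) (v[1]) (- w[1]).
Proof.
have I1 T : is_iso (idm T : mor T T) by exists (idm T); rewrite cmp1f.
have IN T : is_iso (- idm T : mor T T).
  by exists (- idm T); rewrite cmpNf cmpfN opprK cmp1f.
split=> [/dist_rot/dist_rot/dist_rot D|D]; last do 3 apply/dist_rot;
  apply: dist_iso (I1 _) (IN _) (I1 _) _ _ _ D;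
  by rewrite ?lmap1 ?cmpNf ?cmpfN ?cmp1f ?cmpf1 ?opprK.
Qed.

Lemma dist_transport X Y Z X' Y' Z' (u : mor X Y) (v : mor Y Z)
    (w : mor Z (sh C X)) :
  isomorphic X X' -> isomorphic Y Y' -> isomorphic Z Z' -> dist u v w ->
  exists (u' : mor X' Y') (v' : mor Y' Z') (w' : mor Z' (sh C X')),
    dist u' v' w'.
Proof.
move=> [a aI] [b bI] [c cI] D.
have [[a' [a'a aa']] [b' [b'b bb']] [c' [c'c cc']]] := And3 aI bI cI.
exists (b \oc u \oc a'), (c \oc v \oc b'), (a[1] \oc w \oc c').
by apply: dist_iso aI bI cI _ _ _ D; rewrite -!cmpA ?a'a ?b'b ?c'c ?cmpf1.
Qed.

End ShiftLemmas.

Section WeightMorphisms.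
Variables (R : comPzRingType) (C : tricat R) (w : weight_structure C).
Implicit Types X Y Z L M N : C.

Lemma wge_pos k X : wge w (Posz k.+1) X -> shiftp (wge0 w) 1 X.
Proof.
move=> [Y [PY XY]]; elim: k X XY => [|k IH] X XY; first by exists Y.
exists (shiftz Y (Posz k.+1)); split=> //; apply: wge0_shift.
exact/IH/iso_refl.
Qed.

Lemma w_orthz i j X Y (f : mor X Y) : i < j -> wle w i X -> wge w j Y -> f = 0.
Proof.
move=> ij [X0 [PX XX0]] [Y0 [PY YY0]].
apply: mor0_iso XX0 YY0 _ f.
have shV k l :
    (forall g : mor (shiftz X0 (k + 1)) (shiftz Y0 (l + 1)), g = 0) <->
    (forall g : mor (shiftz X0 k) (shiftz Y0 l), g = 0).
  split=> [H|/mor0_sh H].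
    by apply/mor0_sh; apply: mor0_iso H; exact: shiftzS.
  by apply: mor0_iso H; exact/iso_sym/shiftzS.
have base l : 0 < l -> forall g : mor (shiftz X0 0) (shiftz Y0 l), g = 0.
  case: l => [[|k]|k] // _; apply: (w_orth (w := w)) => //.
  by apply: (@wge_pos k); exists Y0; split=> //; exact: iso_refl.
elim/int_rect: i j ij => [j|n IH j ij|n IH j ij]; first exact: base.
  have ->: j = (j - 1) + 1 by rewrite subrK.
  by rewrite -addn1 PoszD; apply/shV/IH; lia.
apply/shV; rewrite (_ : - n.+1%:Z + 1 = - n%:Z); last lia.
by apply: IH; lia.
Qed.

Lemma dec_mor_ex m n M N (d : weight_dec w m M) (e : weight_dec w n N)
    (f : mor M N) : m <= n ->
  exists g, exists h, dec_mor d e f g h.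
Proof.
move=> mn.
have [|g gE] := dist_lift (f := f \oc wda d) (wd_dist e).
  by apply: w_orthz (wdL_le d) (wdR_ge e); lia.
have [|h [h1 h2]] := dist_mor (f := g) (g := f) (wd_dist d) (wd_dist e) => //.
by exists g, h.
Qed.

Lemma dec_mor_uniqL m n M N (d : weight_dec w m M) (e : weight_dec w n N)
    (g g' : mor (wdL d) (wdL e)) : m < n ->
  wda e \oc g = wda e \oc g' -> g = g'.
Proof.
move=> mn gg'; apply/eqP; rewrite -subr_eq0; apply/eqP; apply: sh_inj.
have D := wd_dist e; move/dist_rot/dist_rot: (D) => {}D.
have [|x <-] := dist_lift (f := (g - g')[1]) D.
  by rewrite cmpNf -lmapM cmpfB gg' subrr linear0 oppr0.
rewrite (_ : x = 0) ?cmpf0 ?linear0 //.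
by apply: w_orthz (shiftp_sh (wdL_le d)) (wdR_ge e); lia.
Qed.

Lemma dec_mor_uniqR m n M N (d : weight_dec w m M) (e : weight_dec w n N)
    (h h' : mor (wdR d) (wdR e)) : m < n ->
  h \oc wdb d = h' \oc wdb d -> h = h'.
Proof.
move=> mn hh'; apply/eqP; rewrite -subr_eq0; apply/eqP.
have /dist_rot D := wd_dist d.
have [|x <-] := dist_colift (f := h - h') D; first by rewrite cmpBf hh' subrr.
rewrite (_ : x = 0) ?cmp0f //.
by apply: w_orthz (shiftp_sh (wdL_le d)) (wdR_ge e); lia.
Qed.

(* weight_decs below is inhabited, by choice *)
Lemma weight_dec_ex m M : inhabited (weight_dec w m M).
Proof.
suff H : forall M, exists (L N : C)
    (a : mor L M) (b : mor M N) (c : mor N (sh C L)),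
    [/\ dist a b c, wle w m L & wge w (m + 1) N].
  by have [L [N [a [b [c [D HL HN]]]]]] := H M; exists; exact: WeightDec D HL HN.
elim/int_rect: m => {M} [|n IH|n IH] M.
- have [L [N [a [b [c [D HL HN]]]]]] := w_dec w M.
  exists L, N, a, b, c; split=> //.
  by exists L; split=> //; exact: iso_refl.
- have [L [N [a [b [c [/dist_sh D HL HN]]]]]] := IH (shi C M).
  have [a' [b' [c' D']]] :=
    dist_transport (iso_refl _) (iso_sym (sh_shi_iso M)) (iso_refl _) D.
  exists (sh C L), (sh C N), a', b', c'; split=> //; rewrite -addn1 PoszD;
  exact: shiftp_sh.
- have [L [N [a [b [c [D HL HN]]]]]] := IH (sh C M).
  have [a' [b' [c' D']]] :=
    dist_transport (sh_shi_iso L) (iso_refl _) (sh_shi_iso N) D.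
  have [[a1 a1E] [b1 b1E] [c1 c1E]] :=
    And3 (sh_full a') (sh_full b') (sh_full (- c')).
  exists (shi C L), (shi C N), a1, b1, c1; split.
  + by apply/dist_sh; rewrite a1E b1E c1E opprK.
  + apply: shiftp_shV; apply: shiftp_iso (iso_sym (sh_shi_iso L)) _.
    by rewrite (_ : - n.+1%:Z + 1 = - n%:Z) //; lia.
  + apply: shiftp_shV; apply: shiftp_iso (iso_sym (sh_shi_iso N)) _.
    by rewrite (_ : - n.+1%:Z + 1 = - n%:Z) //; lia.
Qed.

End WeightMorphisms.

Section VirtualTruncations.
Variables (R : comPzRingType) (C : tricat R) (w : weight_structure C).

Definition weight_decs : Type := forall (m : int) (M : C), weight_dec w m M.

Variable D : weight_decs.

Definition w_le (m : int) (M : C) : C := wdL (D m M).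
Definition w_ge (m : int) (M : C) : C := wdR (D (m - 1) M).

Lemma w_le_map_ex m n (mn : m <= n) (M N : C) (f : mor M N) :
  exists g : mor (w_le m M) (w_le n N),
    exists h, dec_mor (D m M) (D n N) f g h.
Proof. exact: dec_mor_ex. Qed.

Lemma w_ge_map_ex m n (mn : m <= n) (M N : C) (f : mor M N) :
  exists h : mor (w_ge m M) (w_ge n N),
    exists g, dec_mor (D (m - 1) M) (D (n - 1) N) f g h.
Proof.
have mn1 : m - 1 <= n - 1 by lia.
by have [g [h gh]] := dec_mor_ex (D (m - 1) M) (D (n - 1) N) f mn1; exists h, g.
Qed.

(* The component of some morphism of triangles over f; it is unique only if   *)
(* m < n.                                                                     *)
Definition w_le_map m n (mn : m <= n) (M N : C) (f : mor M N) :
  mor (w_le m M) (w_le n N) := projT1 (cid (w_le_map_ex mn f)).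

Definition w_ge_map m n (mn : m <= n) (M N : C) (f : mor M N) :
  mor (w_ge m M) (w_ge n N) := projT1 (cid (w_ge_map_ex mn f)).

Lemma w_le_mapE m n (mn : m <= n) (M N : C) (f : mor M N) :
  wda (D n N) \oc w_le_map mn f = f \oc wda (D m M).
Proof. by rewrite /w_le_map; case: cid => g [h []]. Qed.

Lemma w_ge_mapE m n (mn : m <= n) (M N : C) (f : mor M N) :
  w_ge_map mn f \oc wdb (D (m - 1) M) = wdb (D (n - 1) N) \oc f.
Proof. by rewrite /w_ge_map; case: cid => g [h []]. Qed.

(* w_{<= m} M -> w_{<= n} M and w_{>= m} M -> w_{>= n} M *)
Definition w_le_conn m n (mn : m < n) (M : C) : mor (w_le m M) (w_le n M) :=
  w_le_map (ltW mn) (idm M).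

Definition w_ge_conn m n (mn : m < n) (M : C) : mor (w_ge m M) (w_ge n M) :=
  w_ge_map (ltW mn) (idm M).

Section Systems.
Variables (m n : int) (mn : m < n).
Let mm : m <= m := lexx m.
Let nn : n <= n := lexx n.

Let leU (M N : C) (g g' : mor (w_le m M) (w_le n N)) :
  wda (D n N) \oc g = wda (D n N) \oc g' -> g = g'.
Proof. exact: dec_mor_uniqL. Qed.

Let geU (M N : C) (g g' : mor (w_ge m M) (w_ge n N)) :
  g \oc wdb (D (m - 1) M) = g' \oc wdb (D (m - 1) M) -> g = g'.
Proof. by apply: dec_mor_uniqR; lia. Qed.

Let leE := (w_le_mapE, cmpA, cmp1f, cmpf1).

Lemma w_le_sys_nat M N (f : mor M N) :
  w_le_conn mn N \oc w_le_map mm f = w_le_map nn f \oc w_le_conn mn M.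
Proof. by apply: leU; rewrite !leE -cmpA w_le_mapE cmp1f. Qed.

Lemma w_le_sys1 M : w_le_conn mn M \oc w_le_map mm (idm M) = w_le_conn mn M.
Proof. by apply: leU; rewrite !leE. Qed.

Lemma w_le_sysM L M N (g : mor M N) (f : mor L M) :
  w_le_conn mn N \oc w_le_map mm (g \oc f) =
  w_le_conn mn N \oc (w_le_map mm g \oc w_le_map mm f).
Proof.
by apply: leU; rewrite !leE -(cmpA g (wda (D m M))) w_le_mapE cmpA. Qed.

Lemma w_le_sysP M N (a : R) (f g : mor M N) :
  w_le_conn mn N \oc w_le_map mm (a *: f + g) =
  w_le_conn mn N \oc (a *: w_le_map mm f + w_le_map mm g).
Proof. by apply: leU; rewrite !leE cmpPl cmpPr !leE. Qed.

Definition w_le_sys : im_system C :=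
  @ImSystem R C (w_le m) (w_le n) (w_le_conn mn)
    (@w_le_map m m mm) (@w_le_map n n nn)
    w_le_sys_nat w_le_sys1 w_le_sysM w_le_sysP.

Let geE := (w_ge_mapE, cmp1f, cmpf1).

Lemma w_ge_sys_nat M N (f : mor M N) :
  w_ge_conn mn N \oc w_ge_map mm f = w_ge_map nn f \oc w_ge_conn mn M.
Proof.
apply: geU; rewrite -[LHS]cmpA -[RHS]cmpA !geE cmpA !geE.
by [].
Qed.

Lemma w_ge_sys1 M : w_ge_conn mn M \oc w_ge_map mm (idm M) = w_ge_conn mn M.
Proof. by apply: geU; rewrite -!cmpA !geE. Qed.

Lemma w_ge_sysM L M N (g : mor M N) (f : mor L M) :
  w_ge_conn mn N \oc w_ge_map mm (g \oc f) =
  w_ge_conn mn N \oc (w_ge_map mm g \oc w_ge_map mm f).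
Proof.
apply: geU; rewrite -!cmpA !geE; congr (_ \oc _).
by rewrite (cmpA (w_ge_map mm g)) w_ge_mapE cmpA.
Qed.

Lemma w_ge_sysP M N (a : R) (f g : mor M N) :
  w_ge_conn mn N \oc w_ge_map mm (a *: f + g) =
  w_ge_conn mn N \oc (a *: w_ge_map mm f + w_ge_map mm g).
Proof. by apply: geU; rewrite -!cmpA cmpPl !geE cmpPr. Qed.

Definition w_ge_sys : im_system C :=
  @ImSystem R C (w_ge m) (w_ge n) (w_ge_conn mn)
    (@w_ge_map m m mm) (@w_ge_map n n nn)
    w_ge_sys_nat w_ge_sys1 w_ge_sysM w_ge_sysP.

End Systems.

Lemma int_ltS (n : int) : n < n + 1. Proof. by rewrite ltrDl. Qed.
Lemma int_ltP (n : int) : n - 1 < n. Proof. by rewrite ltrBlDr int_ltS. Qed.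

Variable H : modfun C.

(* tau^{>= -n}(H)(M) = Im(H(w_{<= n+1} M) -> H(w_{<= n} M)) *)
Definition tau_ge_opp (n : int) : modfun C := imfun H (w_le_sys (int_ltS n)).

(* tau^{<= -n}(H)(M) = Im(H(w_{>= n} M) -> H(w_{>= n-1} M)) *)
Definition tau_le_opp (n : int) : modfun C := imfun H (w_ge_sys (int_ltP n)).

End VirtualTruncations.

(* Main.v *)
Require Import Defs.
From HB Require Import structures.
From mathcomp Require Import all_boot all_order all_algebra.
From mathcomp Require Import boolp zify.

(** Virtual truncations preserve exactness for the following reason. A class in
    tau^(>= -n) H(Y) comes from w_(<= n+1) Y. If it dies on X, in a triangle X
    -> Y -> Z, it lifts to the cone E of w_(<= n) X -> w_(<= n+1) Y. E need not
    be a weight truncation of Z, but a four lemma argument shows that maps to Z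
    from objects of weight <= n + 1 lift to E, uniquely in weight <= n, and
    this is enough to move the lift to w_(<= n+1) Z ([w_le_cone_lift]); the
    other truncation is treated in the same spirit ([w_ge_cone_lift]). Finite
    generation passes to images, and on M[i] with i far from zero the
    connecting map of truncations either vanishes or factors through M[i].

    If finite type means representable, the truncations of C(-, M) are
    therefore representable. Let L represent tau^(<= 0) C(-, M). The canonical
    map from the truncation to C(-, M) is bijective on weight >= 0 and
    injective on weight >= -1, so it corresponds to a map L -> M whose cone
    receives nothing from weight >= 0, while L itself has weight >= 0: this is
    the t-decomposition of M ([orth_triangle]).

    An object M in the heart of t has a presentation Q -> P -> M by objects of
    the heart of w, up to pieces of weight >= 1, from which nothing maps to the
    heart of t. This gives full faithfulness of the restricted Yoneda functor.

    For essential surjectivity, a functor A on the heart of w is extended to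
    the whole category in two steps: a right Kan extension to w >= 0, which is
    a submodule of A(w_(<= 0) X), and then a left Kan extension, a quotient of
    the value at w_(>= 0) M. The first step is left exact on triangles inside w
    >= 0, and this suffices for the second to produce a cohomological functor
    ([aisle_ext_cohomological]). It vanishes in weights <= -1 and >= 1, so
    boundedness gives the vanishing for almost all shifts; submodules and
    quotients of the modules A(P) are finitely generated because R is
    noetherian. The object that represents it lies in the heart of t and
    restricts to A. *)

Set Implicit Arguments.
Unset Strict Implicit.
Unset Printing Implicit Defensive.

Import Order.TTheory GRing.Theory Num.Theory.
Local Open Scope ring_scope.

(** * Exact sequences of morphisms attached to a triangle *)

Section LinearComposition.
Variables (R : comPzRingType) (C : lincat R).
Implicit Types X Y Z : C.

Lemma cmpDf X Y Z (g g' : mor Y Z) (f : mor X Y) :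
  (g + g') \oc f = g \oc f + g' \oc f.
Proof. by rewrite -[g in LHS]scale1r cmpPl scale1r. Qed.

Lemma cmpfD X Y Z (g : mor Y Z) (f f' : mor X Y) :
  g \oc (f + f') = g \oc f + g \oc f'.
Proof. by rewrite -[f in LHS]scale1r cmpPr scale1r. Qed.

End LinearComposition.

Section Triangles.
Variables (R : comPzRingType) (C : tricat R).
Implicit Types X Y Z T : C.

Lemma dist_rotate X Y Z (u : mor X Y) (v : mor Y Z) (w : mor Z (sh C X)) :
  dist u v w -> dist v w (- u[1]).
Proof. exact: (proj1 (dist_rot u v w)). Qed.

Section Exactness.
Variables (X Y Z : C) (u : mor X Y) (v : mor Y Z) (w : mor Z (sh C X)).
Hypothesis uvw : dist u v w.

Lemma dist_comp0 : v \oc u = 0.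
Proof.
have [[Z0 Z0z] _] := tri_additive C.
have [|h [<- _]] := dist_mor (f := idm X) (g := u) (dist_one X Z0z) uvw => //.
exact: cmpf0.
Qed.

Lemma dist_comp0S : w \oc v = 0.
Proof.
have [[Z0 Z0z] _] := tri_additive C.
have vwu := dist_rotate uvw.
have [|h [<- _]] := dist_mor (f := idm Y) (g := v) (dist_one Y Z0z) vwu => //.
exact: cmpf0.
Qed.

Lemma dist_comp0SS : u[1] \oc w = 0.
Proof.
have [[Z0 Z0z] _] := tri_additive C.
have wuv := dist_rotate (dist_rotate uvw).
have [|h [E _]] := dist_mor (f := idm Z) (g := w) (dist_one Z Z0z) wuv => //.
by apply: oppr_inj; rewrite -cmpNf -E cmpf0 oppr0.
Qed.

Lemma dist_liftS T (f : mor T Z) : w \oc f = 0 -> exists g, v \oc g = f.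
Proof. exact: dist_lift (dist_rotate uvw). Qed.

Lemma dist_liftSS T (f : mor T (sh C X)) :
  u[1] \oc f = 0 -> exists g, w \oc g = f.
Proof.
have D := dist_rotate (dist_rotate uvw); move=> uf; apply: dist_lift D _.
by rewrite cmpNf uf oppr0.
Qed.

Lemma dist_coliftS T (f : mor Z T) : f \oc v = 0 -> exists g, g \oc w = f.
Proof. exact: dist_colift (dist_rotate uvw). Qed.

(** Rotating backwards replaces Z by (Z[-1])[1], to which it is only
    isomorphic, so the third map of the rotated triangle is not pinned down; k
    is all that lifting arguments need. *)
Lemma dist_fiber : exists (k : mor (shi C Z) X) (v' : mor Y (sh C (shi C Z))),
  dist k u v'.
Proof.
have [eta [eI _]] := sh_shi C; have [e' [e'e ee']] := eI Z.
have [k kE] := sh_full (- (w \oc e')); exists k, (eta Z \oc v).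
apply/dist_rot; rewrite kE opprK.
have I1 (S : C) : is_iso (idm S) by exists (idm S); rewrite cmp1f.
apply: (dist_iso (I1 X) (I1 Y) (eI Z) _ _ _ uvw);
  rewrite ?lmap1 ?cmp1f ?cmpf1 //.
by rewrite -cmpA e'e cmpf1.
Qed.

Lemma dist_zero_iso : is_zero X -> is_iso v.
Proof.
move=> X0.
have X10 := is_zero_sh X0.
have [|g vg] := dist_liftS (f := idm Z); first exact: zero_to.
exists g; split=> //; apply/eqP; rewrite -subr_eq0; apply/eqP.
have [|h <-] := dist_lift (f := g \oc v - idm Y) uvw.
  by rewrite cmpfB cmpA vg cmp1f cmpf1 subrr.
by rewrite (zero_to h X0) cmpf0.
Qed.

End Exactness.

(** Shifts are iterated on the left and the shift is only an equivalence, so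
    M[i][j] and M[i+j] are not the same object: this turns stability under a
    single shift, in both directions, into stability under all of them. *)
Lemma shiftz_family (Q : int -> C -> Prop) :
  (forall i X Y, isomorphic X Y -> Q i Y -> Q i X) ->
  (forall i X, Q i X -> Q (i + 1) (sh C X)) ->
  (forall i X, Q (i + 1) (sh C X) -> Q i X) ->
  forall i j X, Q i X -> Q (i + j) (shiftz X j).
Proof.
move=> QI QS QV i j X QX; elim/int_rect: j => [|n IH|n IH].
- by rewrite addr0.
- have := QS _ _ IH; rewrite -addrA -addn1 PoszD; apply: QI.
  exact/iso_sym/shiftzS.
- apply: QV; rewrite -addrA (_ : - n.+1%:Z + 1 = - n%:Z); last lia.
  apply: QI IH; rewrite (_ : - n%:Z = - n.+1%:Z + 1); last lia.
  exact: shiftzS.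
Qed.

Lemma shiftp_shiftz (P : C -> Prop) i j X :
  shiftp P i X -> shiftp P (i + j) (shiftz X j).
Proof.
apply: shiftz_family => [k S T|k S|k S].
- exact: shiftp_iso.
- exact: shiftp_sh.
- exact: shiftp_shV.
Qed.

Lemma shiftz_sh X i : isomorphic (shiftz (sh C X) i) (shiftz X (i + 1)).
Proof.
have [|S [<- ]] := @shiftp_shiftz (eq X) 1 i (sh C X).
  by exists X; split=> //; exact: iso_refl.
by rewrite addrC.
Qed.

Lemma shiftp_shi (P : C -> Prop) i X :
  shiftp P i X -> shiftp P (i - 1) (shi C X).
Proof.
move=> PX; apply: shiftp_shV; rewrite subrK.
exact: shiftp_iso (iso_sym (sh_shi_iso X)) PX.
Qed.

End Triangles.

(** * Weight decompositions and orthogonality *)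

Section WeightTheory.
Variables (R : comPzRingType) (C : tricat R) (w : weight_structure C).
Implicit Types X Y Z T L M N : C.

Lemma iso_retract X Y : isomorphic X Y -> is_retract X Y.
Proof. by case=> f [g [gf _]]; exists f, g. Qed.

Lemma wle0P X : wle w 0 X <-> wle0 w X.
Proof.
split=> [[Y [PY XY]]|PX]; last by exists X; split=> //; exact: iso_refl.
exact: wle0_retract (iso_retract XY) PY.
Qed.

Lemma wge0P X : wge w 0 X <-> wge0 w X.
Proof.
split=> [[Y [PY XY]]|PX]; last by exists X; split=> //; exact: iso_refl.
exact: wge0_retract (iso_retract XY) PY.
Qed.

Lemma wle_leS i X : wle w i X -> wle w (i + 1) X.
Proof.
move=> [Y [PY XY]]; apply: shiftp_iso XY _.
by rewrite addrC; apply: shiftp_shiftz; exact: wle0_shift.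
Qed.

Lemma wge_geS i X : wge w (i + 1) X -> wge w i X.
Proof.
move=> [Y [PY XY]]; exists (sh C Y); split; last first.
  exact: iso_trans XY (iso_sym (shiftz_sh _ _)).
by apply: wge0_shift; exists Y; split=> //; exact: iso_refl.
Qed.

Lemma wle_le i j X : i <= j -> wle w i X -> wle w j X.
Proof.
move=> ij PX; have -> : j = i + `|j - i|%N by lia.
elim: `|j - i|%N => [|k IH]; first by rewrite addr0.
by rewrite -addn1 PoszD addrA; exact: wle_leS.
Qed.

Lemma wge_ge i j X : j <= i -> wge w i X -> wge w j X.
Proof.
move=> ij; have -> : i = j + `|i - j|%N by lia.
elim: `|i - j|%N => [|k IH]; first by rewrite addr0.
by rewrite -addn1 PoszD addrA => /wge_geS.
Qed.

Section Decomposition.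
Variables (m : int) (M : C) (d : weight_dec w m M).

Lemma wd_lift T (f : mor T M) : wle w m T -> exists g, wda d \oc g = f.
Proof.
by move=> Tm; apply: dist_lift (wd_dist d) _; apply: w_orthz Tm (wdR_ge d); lia.
Qed.

(** The kernel of composition with w_{<= m} M -> M comes from maps into (w_{>=
    m+1} M)[-1], which is of weight >= m. *)
Lemma wd_inj k T (g g' : mor T (wdL d)) : wle w k T -> k < m ->
  wda d \oc g = wda d \oc g' -> g = g'.
Proof.
move=> Tk km E; apply/eqP; rewrite -subr_eq0; apply/eqP; apply: sh_inj.
have [|x <-] := dist_liftSS (f := (g - g')[1]) (wd_dist d).
  by rewrite -lmapM cmpfB E subrr linear0.
rewrite linear0 (_ : x = 0) ?cmpf0 //.
by apply: w_orthz (shiftp_sh Tk) (wdR_ge d); lia.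
Qed.

Lemma wd_colift T (f : mor M T) : wge w (m + 1) T -> exists g, g \oc wdb d = f.
Proof.
move=> Tm; apply: dist_colift (wd_dist d) _.
by apply: w_orthz (wdL_le d) Tm; lia.
Qed.

(** Two extensions to w_{>= m+1} M of one morphism out of M differ by a
    morphism out of (w_{<= m} M)[1]. *)
Lemma wd_coinj T (g g' : mor (wdR d) T) :
  (forall S (f : mor S T), wle w (m + 1) S -> f = 0) ->
  g \oc wdb d = g' \oc wdb d -> g = g'.
Proof.
move=> T0 E; apply/eqP; rewrite -subr_eq0; apply/eqP.
have [|x <-] := dist_coliftS (f := g - g') (wd_dist d).
  by rewrite cmpBf E subrr.
by rewrite (T0 _ x) ?cmp0f //; exact: shiftp_sh (wdL_le d).
Qed.

Lemma wdcbK : wdc d \oc wdb d = 0. Proof. exact: dist_comp0S (wd_dist d). Qed.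

(** The long exact sequences of C(T, -) for a triangle on X, Y, Z run into X[1]
    and Y[1], where the lifting lemmas are needed as well. *)
Definition shift_dec : weight_dec w (m + 1) (sh C M) :=
  WeightDec (proj1 (dist_sh _ _ _) (wd_dist d)) (shiftp_sh (wdL_le d))
    (shiftp_sh (wdR_ge d)).

End Decomposition.

Lemma weight_dec_choice : exists _ : weight_decs w, True.
Proof.
suff D m M : weight_dec w m M by exists D.
have H : exists _ : weight_dec w m M, True.
  by case: (weight_dec_ex w m M) => d; exists d.
exact: projT1 (cid H).
Qed.

(** If nothing of weight <= -1 maps to X, then X is a retract of w_{>= 0} X. *)
Lemma wge0_orth X :
  (forall T (f : mor T X), wle w (-1) T -> f = 0) -> wge0 w X.
Proof.
move=> X0; have [d] := weight_dec_ex w (-1) X.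
have a0 : wda d = 0 by apply: X0; exact: wdL_le.
have [|s sb] := dist_colift (f := idm X) (wd_dist d).
  by rewrite a0 cmpf0.
apply: (wge0_retract (Y := wdR d)); first by exists (wdb d), s.
exact/wge0P/(wdR_ge d).
Qed.

Lemma wge0_orthP X :
  wge0 w X <-> forall T (f : mor T X), wle w (-1) T -> f = 0.
Proof.
split; last exact: wge0_orth.
by move=> /wge0P X0 T f Tl; apply: w_orthz Tl X0.
Qed.

(** A morphism from weight <= -1 to w_{<= 0} X is determined by its composite
    to X, which vanishes. *)
Lemma wdL_heart X (d : weight_dec w 0 X) : wge0 w X -> w_heart w (wdL d).
Proof.
move=> X0; split; first exact/wle0P/(wdL_le d).
apply/wge0_orthP => T f Tl; apply: (wd_inj (d := d) Tl) => //.
by rewrite cmpf0; move/wge0_orthP: X0; apply.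
Qed.

End WeightTheory.

(** * Virtual truncations of functors of finite type *)

Lemma fin_gen_surj (R : pzRingType) (U V : lmodType R) (f : {linear U -> V}) :
  (forall y, exists x, y = f x) -> fin_gen U -> fin_gen V.
Proof.
move=> fS [n [v vE]]; exists n, (f \o v) => y.
have [x ->] := fS y; have [c ->] := vE x; exists c.
by rewrite linear_sum; apply: eq_bigr => i _; rewrite linearZ.
Qed.

Lemma mmap0 (R : comPzRingType) (C : lincat R) (F : modfun C) (X Y : C)
    (x : F Y) : mmap F (0 : mor X Y) x = 0.
Proof.
have := mmapP (1 : R) (0 : mor X Y) 0 x.
by rewrite !scale1r addr0 -{1}[mmap F 0 x]addr0 => /addrI.
Qed.

Section ImageFunctors.
Variables (R : comPzRingType).

Lemma fin_gen_im (U V : lmodType R) (f : {linear U -> V}) :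
  fin_gen U -> fin_gen (im_mod f).
Proof.
have fP x : f x \in im_pred f by apply/im_predP; exists x.
pose g x : im_mod f := ImType (fP x).
have gL : linear g by move=> a x y; apply: val_inj; rewrite /= linearP.
pose gl : {linear U -> im_mod f} :=
  HB.pack g (GRing.isLinear.Build R U (im_mod f) *:%R g gL).
apply: (fin_gen_surj (f := gl)) => -[y yP]; have /im_predP[x yx] := yP.
by exists x; apply: val_inj.
Qed.

Variable C : tricat R.
Variables (H : modfun C) (S : im_system C).

Lemma imfun_eq0 M : (forall x, mmap H (sc S M) x = 0) ->
  forall x : imfun H S M, x = 0.
Proof.
move=> sc0 [x xP]; apply: val_inj => /=.
by case/im_predP: (xP) => y ->; rewrite sc0.
Qed.

(** A class on Y that dies on X lifts to the cone E of the map sA X -> sB Y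
    because H is cohomological. The cone need not be sB Z, but a morphism e :
    sB Z -> E compatible with the triangle suffices to carry the lift over to
    Z, since classes are only seen through the structure maps of the system. *)
Lemma imfun_cohomological :
  (forall (X Y Z : C) (u : mor X Y) (v : mor Y Z) (w : mor Z (sh C X)),
    dist u v w -> forall E (l : mor (sB S Y) E) r,
    dist (sc S Y \oc sAmap S u) l r ->
    exists e : mor (sB S Z) E,
      e \oc (sc S Z \oc sAmap S v) = l \oc sc S Y) ->
  cohomological H -> cohomological (imfun H S).
Proof.
move=> lift cH X Y Z u v w uvw y; split; last first.
  case=> z ->; rewrite -[LHS](mmapM (m := imfun H S)) (dist_comp0 uvw).
  exact: mmap0.
case: y => y yP; case/im_predP: (yP) => y' yE uy0.
have [E [l [r klr]]] := dist_cone (sc S Y \oc sAmap S u).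
have [e eE] := lift _ _ _ _ _ _ uvw _ _ _ klr.
have [|z y'z] := (cH _ _ _ _ _ _ klr y').1.
  by rewrite mmapM -yE; exact: (congr1 (@im_val _ _ _ _) uy0).
have zP : mmap H (sc S Z) (mmap H e z) \in im_pred (mmap H (sc S Z)).
  by apply/im_predP; exists (mmap H e z).
exists (ImType zP); apply: val_inj => /=.
by rewrite yE y'z -!mmapM eE.
Qed.

End ImageFunctors.

Section VirtualTruncationTheory.
Variables (R : comPzRingType) (C : tricat R) (w : weight_structure C).
Variable D : weight_decs w.
Implicit Types X Y Z M N : C.

Section WeightLeSystem.
Variable n : int.
Let S := w_le_sys D (int_ltS n).

(** If M has weight <= n, then the identity of M lifts to w_{<= n+1} M, and the
    connecting morphism must be the one that passes through M. *)
Lemma w_le_conn_wle M : wle w n M ->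
  exists s : mor M (w_le D (n + 1) M),
    w_le_conn D (int_ltS n) M = s \oc wda (D n M).
Proof.
move=> Mn; have [s sE] := wd_lift (D (n + 1) M) (idm M) (wle_leS Mn).
exists s; apply: (wd_inj (wdL_le (D n M)) (int_ltS n)).
by rewrite w_le_mapE cmpA sE.
Qed.

Lemma w_le_conn_wge M : wge w (n + 1) M -> w_le_conn D (int_ltS n) M = 0.
Proof.
move=> Mn; apply: (wd_inj (wdL_le (D n M)) (int_ltS n)).
rewrite w_le_mapE cmp1f cmpf0.
by apply: w_orthz (wdL_le _) Mn; lia.
Qed.

(** The cone E of w_{<= n} X -> w_{<= n+1} Y behaves like w_{<= n+1} Z when
    tested on objects T of small weight. By the four lemma for the long exact
    sequences of C(T, -), the map C(T, E) -> C(T, Z) is surjective if T has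
    weight <= n + 1 and injective if T has weight <= n. Surjectivity for T =
    w_{<= n+1} Z gives e, injectivity for T = w_{<= n} Y its compatibility. *)
Lemma w_le_cone_lift X Y Z (u : mor X Y) (v : mor Y Z) (t : mor Z (sh C X))
    E (l : mor (sB S Y) E) r :
  dist u v t -> dist (sc S Y \oc sAmap S u) l r ->
  exists e : mor (sB S Z) E, e \oc (sc S Z \oc sAmap S v) = l \oc sc S Y.
Proof.
set k := sc S Y \oc sAmap S u => uvt klr.
pose dX := D n X; pose dY := D (n + 1) Y.
have kE : wda dY \oc k = u \oc wda dX.
  by rewrite cmpA [wda dY \oc _]w_le_mapE cmp1f w_le_mapE.
have [h [hl hr]] := dist_mor klr uvt kE.
have lift T (g : mor T Z) : wle w (n + 1) T -> exists e, h \oc e = g.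
  move=> Tn.
  have [s sE] := wd_lift (shift_dec dX) (t \oc g) Tn.
  have [|e0 e0E] := dist_liftSS (f := s) klr.
    apply: (wd_inj (d := shift_dec dY) Tn); first exact: int_ltS.
    by rewrite /= cmpf0 cmpA -lmapM kE lmapM -cmpA [_ \oc s]sE cmpA
      (dist_comp0SS uvt) cmp0f.
  have [|y yE] := dist_liftS (f := g - h \oc e0) uvt.
    by rewrite cmpfB cmpA -hr -cmpA e0E [_ \oc s]sE subrr.
  have [y' y'E] := wd_lift dY y Tn.
  by exists (e0 + l \oc y'); rewrite cmpfD cmpA hl -cmpA y'E yE addrC subrK.
have inj T (e : mor T E) : wle w n T -> h \oc e = 0 -> e = 0.
  move=> Tn he.
  have [|y ye] := dist_liftS (f := e) klr.
    apply: (wd_inj (d := shift_dec dX) Tn); first exact: int_ltS.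
    by rewrite /= cmpf0 cmpA hr -cmpA he cmpf0.
  have [|x xE] := dist_lift (f := wda dY \oc y) uvt.
    by rewrite cmpA -hl -cmpA ye he.
  have [x' x'E] := wd_lift dX x Tn.
  have -> : e = l \oc (k \oc x').
    rewrite -ye; congr (_ \oc _); apply: (wd_inj Tn (int_ltS n)).
    by rewrite [RHS]cmpA [wda _ \oc k]kE -cmpA x'E xE.
  by rewrite cmpA (dist_comp0 klr) cmp0f.
have [e eE] := lift _ (wda (D (n + 1) Z)) (wdL_le _); exists e.
apply/eqP; rewrite -subr_eq0; apply/eqP.
apply: inj; first exact: wdL_le.
rewrite cmpfB !cmpA eE hl -!cmpA [_ \oc sc S Y]w_le_mapE cmp1f.
by rewrite cmpA [_ \oc sc S Z]w_le_mapE cmp1f w_le_mapE subrr.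
Qed.

End WeightLeSystem.

Section WeightGeSystem.
Variable n : int.
Let S := w_ge_sys D (int_ltP n).

Lemma w_ge_orth X Y T (g g' : mor (w_ge D (n - 1) X) T) :
  (forall U (f : mor U T), wle w (n - 1) U -> f = 0) ->
  g \oc wdb (D (n - 1 - 1) X) = g' \oc wdb (D (n - 1 - 1) X) -> g = g'.
Proof.
by move=> T0; apply: wd_coinj => U f Un; apply: T0; rewrite subrK in Un.
Qed.

Lemma w_ge_ge M : wge w n (w_ge D n M).
Proof. by have := wdR_ge (D (n - 1) M); rewrite subrK. Qed.

Lemma w_ge_conn_wge M (s : mor (w_ge D (n - 1) M) M) :
  s \oc wdb (D (n - 1 - 1) M) = idm M ->
  w_ge_conn D (int_ltP n) M = wdb (D (n - 1) M) \oc s.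
Proof.
move=> sE; apply: w_ge_orth => //.
  by move=> U f Un; apply: w_orthz Un (w_ge_ge M); lia.
by rewrite w_ge_mapE -cmpA sE.
Qed.

Lemma w_ge_conn_wle M : wle w (n - 1) M -> w_ge_conn D (int_ltP n) M = 0.
Proof.
move=> Mn; apply: w_ge_orth => //.
  by move=> U f Un; apply: w_orthz Un (w_ge_ge M); lia.
by rewrite w_ge_mapE cmp0f cmpf1; apply: w_orthz Mn (w_ge_ge M); lia.
Qed.

(** Here E is right orthogonal to weight <= n - 1, being an extension of
    objects with this property; so Z -> E extends to w_{>= n} Z, and maps to E
    out of w_{>= n-1} Y are determined by their restriction to Y. *)
Lemma w_ge_cone_lift X Y Z (u : mor X Y) (v : mor Y Z) (t : mor Z (sh C X))
    E (l : mor (sB S Y) E) r :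
  dist u v t -> dist (sc S Y \oc sAmap S u) l r ->
  exists e : mor (sB S Z) E, e \oc (sc S Z \oc sAmap S v) = l \oc sc S Y.
Proof.
set k := sc S Y \oc sAmap S u => uvt klr.
have kE : k \oc wdb (D (n - 1 - 1) X) = wdb (D (n - 1) Y) \oc u.
  rewrite -cmpA [sAmap S u \oc _]w_ge_mapE cmpA.
  by rewrite [sc S Y \oc _]w_ge_mapE cmpf1.
have [h [hv hr]] := dist_mor uvt klr (esym kE).
have E0 T (f : mor T E) : wle w (n - 1) T -> f = 0.
  move=> Tn; have [|y <-] := dist_liftS (f := f) klr.
    by apply: w_orthz Tn (shiftp_sh (wdR_ge _)); lia.
  rewrite (_ : y = 0) ?cmpf0 //; apply: w_orthz Tn (w_ge_ge Y); lia.
have [|e eE] := dist_colift (f := h) (wd_dist (D (n - 1) Z)).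
  by apply: E0; exact: wdL_le.
exists e; apply: w_ge_orth => //.
rewrite -!cmpA [sc S Y \oc _]w_ge_mapE [sAmap S v \oc _]w_ge_mapE cmpf1 -hv.
by rewrite (cmpA (sc S Z)) [sc S Z \oc _]w_ge_mapE cmpf1 cmpA eE.
Qed.

End WeightGeSystem.

Lemma int_gap (p q : int) :
  exists s : seq int, forall i, i \notin s -> i <= p \/ q <= i.
Proof.
exists [seq p + k%:Z | k <- iota 0 `|q - p|%N] => i iS.
have [ip|pi] := leP i p; first by left.
right; rewrite leNgt; apply: contra iS => iq; apply/mapP.
by exists `|i - p|%N; rewrite ?mem_iota; lia.
Qed.

Hypothesis w_bd : w_bounded w.

(** By boundedness M[i] has weight <= p for small i and weight >= q for large
    i. *)
Lemma vanishing_shifts (F : modfun C) (P : C -> Prop) p q :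
  (forall M, wle w p M -> P M -> forall x : F M, x = 0) ->
  (forall M, wge w q M -> P M -> forall x : F M, x = 0) ->
  forall M,
  (exists s : seq int, forall i, i \notin s -> P (shiftz M i)) ->
  exists s : seq int, forall i, i \notin s -> forall x : F (shiftz M i), x = 0.
Proof.
move=> Fp Fq M [s sE]; have [[a aM] [b bM]] := w_bd M.
have [s' s'E] := int_gap (p - a) (q - b); exists (s ++ s') => i.
rewrite mem_cat negb_or => /andP[/sE Hi /s'E[ip|qi]].
  by apply: Fp => //; apply: wle_le (shiftp_shiftz i aM); lia.
by apply: Fq => //; apply: wge_ge (shiftp_shiftz i bM); lia.
Qed.

Variable (H : modfun C) (n : int).
Hypothesis H_ft : finite_type H.

Lemma tau_ge_opp_finite_type : finite_type (tau_ge_opp D H n).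
Proof.
have [cH fH] := H_ft; split.
  apply: imfun_cohomological cH => X Y Z u v t uvt E l r.
  exact: w_le_cone_lift uvt.
move=> M; split; first by apply: fin_gen_im; exact: (fH _).1.
apply: (vanishing_shifts (P := fun N => forall x : H N, x = 0)
  (p := n) (q := n + 1)) (fH M).2.
  move=> N Nn H0; apply: imfun_eq0 => x.
  have [s] := w_le_conn_wle Nn; rewrite /= => ->.
  by rewrite mmapM (H0 (mmap H s x)) linear0.
move=> N Nn _; apply: imfun_eq0 => x.
by rewrite /= w_le_conn_wge // mmap0.
Qed.

Lemma tau_le_opp_finite_type : finite_type (tau_le_opp D H n).
Proof.
have [cH fH] := H_ft; split.
  apply: imfun_cohomological cH => X Y Z u v t uvt E l r.
  exact: w_ge_cone_lift uvt.
move=> M; split; first by apply: fin_gen_im; exact: (fH _).1.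
apply: (vanishing_shifts (P := fun N => forall x : H N, x = 0)
  (p := n - 1) (q := n - 1)) (fH M).2.
  move=> N Nn _; apply: imfun_eq0 => x.
  by rewrite /= w_ge_conn_wle // mmap0.
move=> N Nn H0; apply: imfun_eq0 => x.
have [|s sE] := @wd_colift _ _ _ _ _ (D (n - 1 - 1) N) N (idm N).
  by rewrite subrK.
by rewrite /= (w_ge_conn_wge sE) mmapM (H0 (mmap H _ x)) linear0.
Qed.

End VirtualTruncationTheory.

(** * The adjacent t-structure *)

Lemma yoneda_representable (R : comPzRingType) (C : lincat R) (M : C) :
  representable (yoneda M).
Proof.
by exists M, (modnat_id _), (modnat_id _); split; exact: modnat_compf1.
Qed.

Section TruncationMap.
Variables (R : comPzRingType) (C : tricat R) (w : weight_structure C).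
Variables (D : weight_decs w) (H : modfun C) (n : int).
Implicit Types X Y : C.

(** The canonical transformation from the truncation of H to H. It is an
    isomorphism on weight >= n and still injective on weight >= n - 1; the
    second fact is what controls the cone of the map that represents it. *)
Definition tau_le_map X (x : tau_le_opp D H n X) : H X :=
  mmap H (wdb (D (n - 1 - 1) X)) (im_val x).

Lemma tau_le_map_nat X Y (f : mor X Y) (x : tau_le_opp D H n Y) :
  tau_le_map (mmap (tau_le_opp D H n) f x) = mmap H f (tau_le_map x).
Proof. by rewrite /tau_le_map /= -!mmapM w_ge_mapE. Qed.

Lemma tau_le_map_inj X (x : tau_le_opp D H n X) : wge w (n - 1) X ->
  tau_le_map x = 0 -> x = 0.
Proof.
move=> Xn; have /im_predP[y xE] := im_valP x.
rewrite /tau_le_map [im_val x]xE -mmapM w_ge_mapE cmpf1 => y0.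
apply: val_inj; rewrite [LHS]xE /=.
have [|s sE] := @wd_colift _ _ _ _ _ (D (n - 1 - 1) X) X (idm X).
  by rewrite subrK.
by rewrite (w_ge_conn_wge sE) mmapM y0 linear0.
Qed.

Lemma tau_le_map_surj X (h : H X) : wge w n X ->
  exists x : tau_le_opp D H n X, tau_le_map x = h.
Proof.
move=> Xn.
have [|s sE] := @wd_colift _ _ _ _ _ (D (n - 1) X) X (idm X).
  by rewrite subrK.
have xP : mmap H (w_ge_conn D (int_ltP n) X) (mmap H s h)
    \in im_pred (mmap H (w_ge_conn D (int_ltP n) X)).
  by apply/im_predP; exists (mmap H s h).
exists (ImType xP).
by rewrite /tau_le_map /= -!mmapM w_ge_mapE cmpf1 sE mmap1.
Qed.

Lemma tau_le_opp_wle X : wle w (n - 1) X ->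
  forall x : tau_le_opp D H n X, x = 0.
Proof.
move=> Xn; apply: imfun_eq0 => x.
by rewrite /= w_ge_conn_wle // mmap0.
Qed.

End TruncationMap.

Section AdjacentTStructure.
Variables (R : comPzRingType) (C : tricat R) (w : weight_structure C).
Implicit Types X Y L M N : C.

Lemma wge_sh i X : wge w i X -> wge w (i + 1) (sh C X).
Proof. exact: shiftp_sh. Qed.

(** Yoneda turns the transformation from the truncation to C(-, M) into a map a
    : L -> M. The truncation vanishes on weight <= -1, which puts L in weight
    >= 0. On X of weight >= 0 the map C(X, L) -> C(X, M) is onto and C(X, L[1])
    -> C(X, M[1]) is one to one, so C(X, cone a) = 0. *)
Lemma orth_triangle M (D : weight_decs w) :
  representable (tau_le_opp D (yoneda M) 0) ->
  exists (L N : C) (a : mor L M) (b : mor M N) (c : mor N (sh C L)),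
    [/\ dist a b c, wge0 w L & forall X (f : mor X N), wge0 w X -> f = 0].
Proof.
move=> [L [p [q [qp pq]]]].
have pK X x : q X (p X x) = x.
  exact: (congr1 (fun s : modnat _ _ => s X x) qp).
have qK X x : p X (q X x) = x.
  exact: (congr1 (fun s : modnat _ _ => s X x) pq).
pose a := tau_le_map (q L (idm L)) : mor L M.
have aE X (f : mor X L) : a \oc f = tau_le_map (q X f).
  have -> : q X f = mmap (tau_le_opp D (yoneda M) 0) f (q L (idm L)).
    by rewrite -ncomp_nat /= /precomp cmp1f.
  by rewrite tau_le_map_nat.
have L0 : wge0 w L.
  apply: wge0_orth => T f T0.
  by rewrite -[f]qK (tau_le_opp_wle _ (q T f)) ?linear0.
have [N [b [c abc]]] := dist_cone a.
exists L, N, a, b, c; split=> // X f /wge0P X0.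
(* C(X, L[1]) -> C(X, M[1]) is C(X[-1], L) -> C(X[-1], M), and X[-1] is in *)
(* w >= -1, where the map from the truncation is injective                 *)
have a_inj (g : mor X (sh C L)) : a[1] \oc g = 0 -> g = 0.
  have [e [e' [e'e _]]] := sh_shi_iso X.
  have [g0 g0E] := sh_full (g \oc e') => ag.
  suff g00 : g0 = 0.
    by rewrite -[g]cmpf1 -e'e cmpA -g0E g00 linear0 cmp0f.
  have ag0 : a \oc g0 = 0.
    by apply: sh_inj; rewrite linear0 lmapM g0E cmpA ag cmp0f.
  have Xm : wge w (0 - 1) (shi C X) by exact: shiftp_shi.
  have := tau_le_map_inj Xm (x := q _ g0); rewrite -aE => /(_ ag0) q0.
  by rewrite -[g0]qK q0 linear0.
have [|f' <-] := dist_liftS (f := f) abc.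
  by apply: a_inj; rewrite cmpA (dist_comp0SS abc) cmp0f.
have [x xE] := tau_le_map_surj D (H := yoneda M) (n := 0) f' X0.
by rewrite -xE -[x]pK -aE cmpA (dist_comp0 abc) cmp0f.
Qed.

(** Orthogonality leaves this as the only possible coaisle of a t-structure
    whose aisle is w >= 0. *)
Definition right_orth_ge1 N : Prop :=
  forall X (f : mor X N), wge w 1 X -> f = 0.

Lemma shift_morP X Y : (forall f : mor (sh C X) Y, f = 0) <->
  (forall f : mor X (shi C Y), f = 0).
Proof.
have YY := sh_shi_iso Y; split=> H.
  by apply/mor0_sh; apply: mor0_iso (iso_refl _) (iso_sym YY) H.
by apply: mor0_iso (iso_refl _) YY _; apply/mor0_sh.
Qed.

Lemma right_orth_ge1_iso X Y :
  isomorphic X Y -> right_orth_ge1 Y -> right_orth_ge1 X.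
Proof.
move=> XY Y1 Z f Z1; apply: mor0_iso (iso_refl Z) XY _ f => g; exact: Y1.
Qed.

Hypothesis C_sat : saturated C.
Hypothesis w_bd : w_bounded w.

Lemma tau_le_opp_representable (D : weight_decs w) M i :
  representable (tau_le_opp D (yoneda M) i).
Proof.
apply/C_sat; apply: tau_le_opp_finite_type => //.
exact/C_sat/yoneda_representable.
Qed.

Lemma tau_ge_opp_representable (D : weight_decs w) M i :
  representable (tau_ge_opp D (yoneda M) i).
Proof.
apply/C_sat; apply: tau_ge_opp_finite_type => //.
exact/C_sat/yoneda_representable.
Qed.

Lemma adjacent_t_structure : exists t : t_structure C, right_adjacent w t.
Proof.
have le0_iso X Y : isomorphic X Y -> wge0 w Y -> wge0 w X.
  by move=> XY; apply: wge0_retract; exact: iso_retract.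
have ge0_shift X : right_orth_ge1 X -> shiftp right_orth_ge1 1 X.
  move=> X1; exists (shi C X); split; last exact: sh_shi_iso.
  move=> Z f Z1; move: f; apply/shift_morP => f; apply: X1.
  by apply: wge_geS; exact: wge_sh.
have orth X Y : shiftp (wge0 w) 1 X -> right_orth_ge1 Y ->
    forall f : mor X Y, f = 0.
  by move=> X1 Y1 f; exact: Y1.
have dec M : exists (L N : C) (a : mor L M) (b : mor M N) (c : mor N (sh C L)),
    [/\ dist a b c, wge0 w L & shiftp right_orth_ge1 (-1) N].
  have [D _] := weight_dec_choice w.
  have [L [N [a [b [c [abc L0 N0]]]]]] :=
    orth_triangle (tau_le_opp_representable D M 0).
  exists L, N, a, b, c; split=> //.
  exists (sh C N); split; last exact: shi_sh_iso.
  move=> X f [X' [X'0 XX']]; apply: mor0_iso XX' (iso_refl _) _ f.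
  by apply/mor0_sh => f; exact: N0.
by exists (TStr le0_iso right_orth_ge1_iso (@wge0_shift _ _ w) ge0_shift
  orth dec).
Qed.

End AdjacentTStructure.

(** * Full faithfulness on the heart *)

Section AdjacentHeart.
Variables (R : comPzRingType) (C : tricat R) (w : weight_structure C).
Variables (t : t_structure C) (wt : right_adjacent w t).
Implicit Types X Y L M N P : C.

Lemma tge0_orth N : tge0 t N -> right_orth_ge1 w N.
Proof.
move=> N0 X f [Y [Y0 XY]]; apply: (t_orth (t := t)) N0 f.
by exists Y; split=> //; apply/wt.
Qed.

(** Truncate N[-1] and shift: the aisle part L satisfies C(L[1], N) = 0, so the
    identity of L[1] factors through the other term of the truncation triangle,
    which receives nothing from L[1]; so L = 0. *)
Lemma orth_tge0 N : right_orth_ge1 w N -> tge0 t N.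
Proof.
move=> N1.
have [L [N' [a [b [c [abc L0 [N0 [N00 N'N0]]]]]]]] := t_dec t (shi C N).
have Lw : wge w 1 (sh C L) by apply: (@wge_sh _ _ w 0); apply/wge0P/wt.
have N'0 X (f : mor X N') : wge w 0 X -> f = 0.
  move=> X0; apply: mor0_iso (iso_refl X) N'N0 _ f; apply/shift_morP => f.
  by apply: tge0_orth N00 _ _ _; exact: wge_sh X0.
have a0 : a = 0 by move: (a); apply/shift_morP => f; exact: N1.
have L00 : is_zero L.
  rewrite /is_zero; apply: sh_inj; rewrite linear0.
  have [|g <-] := dist_liftSS (f := (idm L)[1]) abc.
    by rewrite a0 linear0 cmp0f.
  by rewrite (N'0 _ g) ?cmpf0 //; exact: (@wge_geS _ _ w 0) Lw.
have NN0 : isomorphic N (sh C N').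
  apply: iso_trans (sh_shi_iso N) _; apply: lin_iso.
  by exists b; exact: dist_zero_iso abc L00.
apply: tge0_iso NN0 _; apply: tge0_iso N00.
apply: iso_trans (lin_iso _ N'N0) _; exact/iso_sym/sh_shi_iso.
Qed.

Lemma t_heart_wge0 N : t_heart t N -> wge0 w N.
Proof. by case=> /wt. Qed.

Lemma t_heart_orth N X (f : mor X N) : t_heart t N -> wge w 1 X -> f = 0.
Proof. by case=> _ /tge0_orth; apply. Qed.

Lemma wdR_ge1 M (d : weight_dec w 0 M) : wge w 1 (wdR d).
Proof. by have := wdR_ge d; rewrite add0r. Qed.

(** w_{<= 0} M -> M is a cover of M by the heart of w, and the rest of M has
    weight >= 1, from which nothing maps to N. *)
Lemma t_heart_faithful M N (h : mor M N) : t_heart t M -> t_heart t N ->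
  (forall X (x : mor X M), w_heart w X -> h \oc x = 0) -> h = 0.
Proof.
move=> Mt Nt h0; have [d] := weight_dec_ex w 0 M.
have [|g <-] := dist_colift (f := h) (wd_dist d).
  by apply: h0; apply: wdL_heart; exact: t_heart_wge0.
by rewrite (t_heart_orth g Nt) ?cmp0f //; exact: wdR_ge1.
Qed.

(** M has a presentation Q -> P -> M with P and Q in the heart of w: P is w_{<=
    0} M and Q covers the fibre of P -> M in the same way. The value of phi at
    P -> M dies on Q by naturality, hence on the whole fibre, as the rest of
    the fibre has weight >= 1; so it factors through M. *)
Lemma t_heart_full M N
    (phi : forall X : full_lincat (w_heart w),
       mor (sval X) M -> mor (sval X) N) :
  t_heart t M -> t_heart t N ->
  (forall X : full_lincat (w_heart w), phi X 0 = 0) ->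
  (forall (X Y : full_lincat (w_heart w)) (f : mor (sval X) (sval Y)) x,
     phi X (x \oc f) = phi Y x \oc f) ->
  exists h : mor M N, forall (X : full_lincat (w_heart w)) x, phi X x = h \oc x.
Proof.
move=> Mt Nt phi0 phiM; have [d] := weight_dec_ex w 0 M.
have Pw : w_heart w (wdL d) by apply: wdL_heart; exact: t_heart_wge0.
pose P : full_lincat (w_heart w) := exist _ (wdL d) Pw.
have [k [v kav]] := dist_fiber (wd_dist d).
have K0 : wge0 w (shi C (wdR d)).
  by apply/wge0P; exact: shiftp_shi (wdR_ge1 d).
have [e] := weight_dec_ex w 0 (shi C (wdR d)).
pose Q : full_lincat (w_heart w) := exist _ (wdL e) (wdL_heart e K0).
have pk0 : phi P (wda d) \oc k = 0.
  have [|g <-] := dist_colift (f := phi P (wda d) \oc k) (wd_dist e).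
    rewrite -cmpA -(phiM Q P) cmpA (dist_comp0 kav) cmp0f.
    exact: (phi0 Q).
  by rewrite (t_heart_orth g Nt) ?cmp0f //; exact: wdR_ge1.
have [h hE] := dist_colift kav pk0; exists h => X x.
have [|y <-] := wd_lift d x; first by apply/wle0P; exact: (proj2_sig X).1.
by rewrite (phiM X P) -hE cmpA.
Qed.

Lemma ryoneda_fully_faithful
    (fg : forall X N, w_heart w X -> t_heart t N -> fin_gen (mor X N)) :
  fully_faithful (ryoneda fg).
Proof.
move=> M N.
have fS (s : chom (ryoneda fg M) (ryoneda fg N)) :
    exists h : mor (sval M) (sval N), ryoneda_map fg h = s.
  have [X|X Y f x|h hE] := @t_heart_full (sval M) (sval N)
    (fun (X : full_lincat (w_heart w)) x => ncomp s X x)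
    (proj2_sig M) (proj2_sig N).
  - exact: linear0.
  - exact: (ncomp_nat s).
  by exists h; apply: modnat_ext => X x; rewrite hE.
exists (fun s => projT1 (cid (fS s))) => [h|s]; last by case: cid.
case: cid => h' h'E /=; apply/eqP; rewrite -subr_eq0; apply/eqP.
apply: t_heart_faithful (proj2_sig M) (proj2_sig N) _ => X x Xw.
have hx : h' \oc x = h \oc x.
  exact: (congr1 (fun s : modnat (sval (ryoneda fg M)) (sval (ryoneda fg N)) =>
    s (exist _ X Xw : full_lincat (w_heart w)) x) h'E).
by rewrite cmpBf hx subrr.
Qed.

End AdjacentHeart.

(** * Cokernels and submodules over a noetherian ring *)

Section Cokernel.
Variables (R : pzRingType) (U V : lmodType R) (f : {linear U -> V}).

Definition coker_type : Type := Quotient.quot (im_pred f).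
HB.instance Definition _ := GRing.Zmodule.on coker_type.

Definition coker_proj (x : V) : coker_type :=
  \pi_(Quotient.quot (im_pred f))%qT x.

Lemma coker_projP x y : coker_proj x = coker_proj y <-> x - y \in im_pred f.
Proof.
by rewrite (rwP eqP) -[x - y \in _]/(Quotient.equiv (im_pred f) x y)
  -Quotient.idealrBE.
Qed.

Lemma coker_projD : {morph coker_proj : x y / x + y}.
Proof. exact: Quotient.pi_add. Qed.

Lemma coker_proj_repr x : coker_proj (repr x) = x.
Proof. exact: reprK. Qed.

Definition coker_scale (a : R) (x : coker_type) : coker_type :=
  coker_proj (a *: repr x).

Lemma coker_projZ a x : coker_scale a (coker_proj x) = coker_proj (a *: x).
Proof.
apply/coker_projP; rewrite -scalerBr; apply: rpredZ.
by apply/coker_projP; exact: coker_proj_repr.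
Qed.

Lemma coker_scaleA a b x :
  coker_scale a (coker_scale b x) = coker_scale (a * b) x.
Proof. by rewrite -[x]coker_proj_repr !coker_projZ scalerA. Qed.

Lemma coker_scale1 : left_id 1 coker_scale.
Proof. by move=> x; rewrite -[x]coker_proj_repr coker_projZ scale1r. Qed.

Lemma coker_scaleDr : right_distributive coker_scale +%R.
Proof.
move=> a x y; rewrite -[x]coker_proj_repr -[y]coker_proj_repr.
by rewrite -coker_projD !coker_projZ scalerDr coker_projD.
Qed.

Lemma coker_scaleDl x : {morph coker_scale^~ x : a b / a + b}.
Proof.
by move=> a b; rewrite -[x]coker_proj_repr !coker_projZ scalerDl coker_projD.
Qed.

HB.instance Definition _ := GRing.Zmodule_isLmodule.Build R coker_type
  coker_scaleA coker_scale1 coker_scaleDr coker_scaleDl.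

Lemma coker_proj_linear : linear coker_proj.
Proof. by move=> a x y; rewrite coker_projD -coker_projZ. Qed.

HB.instance Definition _ :=
  GRing.isLinear.Build R V coker_type *:%R coker_proj coker_proj_linear.

Definition coker_mod : lmodType R := coker_type.
Definition coker_pi : {linear V -> coker_mod} := coker_proj.

Lemma coker_pi_eq0 x : coker_pi x = 0 <-> exists y, x = f y.
Proof.
rewrite -(linear0 coker_pi); split.
  by move/coker_projP; rewrite subr0 => /im_predP.
by move=> xf; apply/coker_projP; rewrite subr0; apply/im_predP.
Qed.

Lemma coker_pi_surj (x : coker_mod) : exists y, x = coker_pi y.
Proof. by exists (repr x); rewrite /coker_pi /= coker_proj_repr. Qed.

End Cokernel.

Section Span.
Variables (R : pzRingType) (V : lmodType R).

(** Recursion on the generators makes the induction of the noetherian argument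
    structural. *)
Fixpoint spans (s : seq V) (x : V) : Prop :=
  if s is v :: s' then exists c : R, spans s' (x - c *: v) else x = 0.

Lemma spans0 s : spans s 0.
Proof. by elim: s => //= v s IH; exists 0; rewrite scale0r subr0. Qed.

Lemma spansZD s a x y : spans s x -> spans s y -> spans s (a *: x + y).
Proof.
elim: s x y => [|v s IH] x y /=; first by move=> -> ->; rewrite scaler0 addr0.
move=> [c xs] [d ys]; exists (a * c + d).
by rewrite scalerDl opprD addrACA -scalerA -scalerBr; exact: IH.
Qed.

Lemma spans_cat s s' x y : spans s x -> spans s' y -> spans (s ++ s') (x + y).
Proof.
elim: s x => [|v s IH] x /=; first by move=> ->; rewrite add0r.
by move=> [c xs] ys; exists c; rewrite addrAC; exact: IH.
Qed.

Lemma spans_map (I : Type) (r : seq I) (v : I -> V) (c : I -> R) :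
  spans (map v r) (\sum_(i <- r) c i *: v i).
Proof.
elim: r => [|i r IH] /=; first by rewrite big_nil.
by exists (c i); rewrite big_cons addrC addKr.
Qed.

Lemma fin_genP : fin_gen V <-> exists s, forall x, spans s x.
Proof.
split=> [[n [v vE]]|[s sE]].
  exists (map v (index_enum 'I_n)) => x; have [c ->] := vE x; exact: spans_map.
exists (size s), (fun i => tnth (in_tuple s) i) => x.
elim: s x {sE}(sE x) => [|v s IH] x /=.
  by move=> ->; exists (fun=> 0); rewrite big_ord0.
move=> [c /IH[d dE]].
exists (fun i => if unlift ord0 i is Some j then d j else c).
rewrite big_ord_recl unlift_none -[LHS](subrK (c *: v)) addrC dE.
congr (_ + _); apply: eq_bigr => i _; rewrite liftK; congr (_ *: _).
by rewrite !(tnth_nth 0).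
Qed.

End Span.

Section Noetherian.
Variables (R : comPzRingType) (U V : lmodType R) (g : {linear U -> V}).
Hypotheses (R_noeth : noetherian R) (g_inj : forall x, g x = 0 -> x = 0).

(** Coefficients on the first generator v of the elements of S form an ideal.
    With finitely many z_i in S realising generators of this ideal, each
    element of S differs from a combination of the z_i by an element of S that
    no longer involves v. *)
Lemma noetherian_spans s (S : U -> Prop) :
  (S 0) -> (forall a x y, S x -> S y -> S (a *: x + y)) ->
  (forall x, S x -> spans s (g x)) ->
  exists t, forall x, S x -> spans t x.
Proof.
elim: s S => [|v s IH] S S0 SL Ss; first by exists [::] => x /Ss /= /g_inj.
pose I (r : R) := exists2 x, S x & spans s (g x - r *: v).
have I_ideal : is_ideal I.
  have IL a r r' : I r -> I r' -> I (a * r + r').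
    move=> [x Sx xr] [y Sy yr]; exists (a *: x + y); first exact: SL.
    have := spansZD a xr yr; congr (spans s _).
    by rewrite linearP scalerDl opprD addrACA -scalerA scalerBr.
  have I0 : I 0 by exists 0 => //; rewrite linear0 scale0r subr0; exact: spans0.
  split=> // [r r'|a r] Ir; last by rewrite -[a * r]addr0; exact: IL.
  by rewrite -[r]mul1r; exact: IL.
have [n [r [rI rE]]] := R_noeth I_ideal.
have rI' i : exists x, S x /\ spans s (g x - r i *: v).
  by have [x Sx xs] := rI i; exists x.
pose z i := projT1 (cid (rI' i)).
have [Sz zs] : (forall i, S (z i)) /\ forall i, spans s (g (z i) - r i *: v).
  by split=> i; have [] := projT2 (cid (rI' i)).
have [|a x y [Sx xs] [Sy ys]|x [_ //]|t tE] :=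
    IH (fun x => S x /\ spans s (g x)).
- by split=> //; rewrite linear0; exact: spans0.
- by split; [exact: SL|rewrite linearP; exact: spansZD].
exists (map z (index_enum 'I_n) ++ t) => x Sx.
have [c cE] := Ss _ Sx; have [|d dE] := rE c; first by exists x.
pose y := \sum_(i < n) d i *: z i.
rewrite -[x](subrK y) addrC; apply: spans_cat; first exact: spans_map.
have [Sy ys] : S y /\ spans s (g y - c *: v).
  rewrite /y dE linear_sum scaler_suml -sumrB.
  split; elim/big_rec: _ => [|i e _ se]; rewrite ?linear0 //.
  - exact: SL.
  - exact: spans0.
  by rewrite linearZ -scalerA -scalerBr; exact: spansZD.
apply: tE; split; first by rewrite addrC -scaleN1r; exact: SL.
rewrite linearB (_ : _ - _ = (-1) *: (g y - c *: v) + (g x - c *: v)).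
  exact: spansZD.
by rewrite scaleN1r opprB [RHS]addrC addrA subrK.
Qed.

Lemma fin_gen_sub : fin_gen V -> fin_gen U.
Proof.
move=> /fin_genP[s sE]; apply/fin_genP.
have [||//|t tE] := @noetherian_spans s (fun=> True) => //.
by exists t => x; exact: tE.
Qed.

End Noetherian.

(** * Extending a functor from the heart to the objects of weight >= 0 *)

Section NaturalIsomorphism.
Variables (R : comPzRingType) (C : lincat R) (F G : modfun C) (s : modnat F G).
Hypothesis s_inj : forall X (x : F X), s X x = 0 -> x = 0.
Hypothesis s_surj : forall X (y : G X), exists x, s X x = y.

Lemma modnat_iso : @cisomorphic (modfun_cat C) F G.
Proof.
have sI X (x x' : F X) : s X x = s X x' -> x = x'.
  by move/eqP; rewrite -subr_eq0 -linearB => /eqP/s_inj/eqP;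
    rewrite subr_eq0 => /eqP.
pose r X y := projT1 (cid (@s_surj X y)).
have rK X y : s X (r X y) = y := projT2 (cid (@s_surj X y)).
have rL X : linear (r X) by move=> a x y; apply: sI; rewrite linearP !rK.
pose rl X : {linear G X -> F X} :=
  HB.pack (r X) (GRing.isLinear.Build R (G X) (F X) *:%R (r X) (rL X)).
have rN X Y (f : mor X Y) y : rl X (mmap G f y) = mmap F f (rl Y y).
  by apply: sI; rewrite /= rK ncomp_nat rK.
exists s, (ModNat rN); split; apply: modnat_ext => X x /=; last exact: rK.
by apply: sI; rewrite rK.
Qed.

End NaturalIsomorphism.

Section FullSubcategory.
Variables (R : comPzRingType) (C : lincat R) (P : C -> Prop).
Variable F : modfun (full_lincat P).
Implicit Types X Y Z : full_lincat P.

Definition fmap_full X Y (f : mor (sval X) (sval Y)) : {linear F Y -> F X} :=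
  @mmap R (full_lincat P) F X Y f.

Lemma fmap_full1 X x : fmap_full (idm (sval X)) x = x.
Proof. exact: (@mmap1 R (full_lincat P) F X x). Qed.

Lemma fmap_fullM X Y Z (g : mor (sval Y) (sval Z))
    (f : mor (sval X) (sval Y)) x :
  fmap_full (g \oc f) x = fmap_full f (fmap_full g x).
Proof. exact: (@mmapM R (full_lincat P) F X Y Z g f x). Qed.

Lemma fmap_fullP X Y a (f g : mor (sval X) (sval Y)) x :
  fmap_full (a *: f + g) x = a *: fmap_full f x + fmap_full g x.
Proof. exact: (@mmapP R (full_lincat P) F X Y a f g x). Qed.

Lemma fmap_full0 X Y x : fmap_full (0 : mor (sval X) (sval Y)) x = 0.
Proof. exact: (@mmap0 R (full_lincat P) F X Y x). Qed.

Lemma fmap_fullN X Y (f : mor (sval X) (sval Y)) x :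
  fmap_full (- f) x = - fmap_full f x.
Proof.
by have := fmap_fullP (-1) f 0 x; rewrite fmap_full0 !addr0 !scaleN1r.
Qed.

Lemma fmap_fullB X Y (f g : mor (sval X) (sval Y)) x :
  fmap_full (f - g) x = fmap_full f x - fmap_full g x.
Proof.
by rewrite -scaleN1r addrC fmap_fullP scaleN1r addrC.
Qed.

End FullSubcategory.

Section HeartExtension.
Variables (R : comPzRingType) (C : tricat R) (w : weight_structure C).
Variable D : weight_decs w.
Local Notation Hw := (full_lincat (w_heart w)).
Local Notation Wge := (full_lincat (wge0 w)).
Variable A : modfun Hw.
Implicit Types (P Q : Hw) (X Y Z : Wge).

(** w_{<= 0} X -> X is a weak precover of X by the heart: morphisms from the
    heart lift along it, though not uniquely. *)
Definition cover X : Hw :=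
  exist _ (wdL (D 0 (sval X))) (wdL_heart (D 0 (sval X)) (proj2_sig X)).

Definition cover_map X : mor (sval (cover X)) (sval X) := wda (D 0 (sval X)).

Lemma cover_lift X P (f : mor (sval P) (sval X)) :
  exists g, cover_map X \oc g = f.
Proof. by apply: wd_lift; apply/wle0P; exact: (proj2_sig P).1. Qed.

(** Elements of A(w_{<= 0} X) that define a natural family C(P, X) -> A(P), for
    P in the heart: the value at f is the restriction along a lift of f, and
    the condition makes it independent of the lift. The resulting functor is
    the right Kan extension of A to w >= 0. *)
Definition heart_ext_pred X : {pred A (cover X)} := fun a =>
  `[< forall P (g : mor (sval P) (sval (cover X))),
      cover_map X \oc g = 0 -> fmap_full A g a = 0 >].

Arguments heart_ext_pred X : clear implicits.

Lemma heart_ext_predP X a :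
  reflect (forall P (g : mor (sval P) (sval (cover X))),
             cover_map X \oc g = 0 -> fmap_full A g a = 0)
          (a \in heart_ext_pred X).
Proof. exact: asboolP. Qed.

Lemma heart_ext_pred_closed X : GRing.submod_closed (heart_ext_pred X).
Proof.
split; first by apply/heart_ext_predP => P g _; rewrite linear0.
move=> a x y /heart_ext_predP x0 /heart_ext_predP y0.
apply/heart_ext_predP => P g g0.
by rewrite linearP x0 // y0 // scaler0 addr0.
Qed.

HB.instance Definition _ X :=
  GRing.isSubmodClosed.Build R (A (cover X)) (heart_ext_pred X)
    (heart_ext_pred_closed X).

Record heart_ext_type X := HeartExt {
  heart_ext_val :> A (cover X);
  heart_ext_valP : heart_ext_val \in heart_ext_pred X }.
HB.instance Definition _ X := [isSub for @heart_ext_val X].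
HB.instance Definition _ X := [Choice of heart_ext_type X by <:].
HB.instance Definition _ X :=
  [SubChoice_isSubLmodule of heart_ext_type X by <:].

Lemma heart_ext_inj X (x y : heart_ext_type X) :
  heart_ext_val x = heart_ext_val y -> x = y.
Proof. exact: val_inj. Qed.

Lemma heart_ext_valZD X a (x y : heart_ext_type X) :
  heart_ext_val (a *: x + y) = a *: heart_ext_val x + heart_ext_val y.
Proof. by []. Qed.

Lemma heart_ext_eq X P (g g' : mor (sval P) (sval (cover X)))
    (a : heart_ext_type X) :
  cover_map X \oc g = cover_map X \oc g' ->
  fmap_full A g (heart_ext_val a) = fmap_full A g' (heart_ext_val a).
Proof.
move=> gg'; apply/eqP; rewrite -subr_eq0 -fmap_fullB; apply/eqP.
by have /heart_ext_predP := heart_ext_valP a; apply; rewrite cmpfB gg' subrr.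
Qed.

Lemma cover_fun_ex X Y (f : mor (sval X) (sval Y)) :
  exists g : mor (sval (cover X)) (sval (cover Y)),
    cover_map Y \oc g = f \oc cover_map X.
Proof. exact: cover_lift. Qed.

Definition cover_fun X Y (f : mor (sval X) (sval Y)) :=
  projT1 (cid (cover_fun_ex f)).

Lemma cover_funE X Y (f : mor (sval X) (sval Y)) :
  cover_map Y \oc cover_fun f = f \oc cover_map X.
Proof. exact: projT2 (cid (cover_fun_ex f)). Qed.

Lemma heart_ext_map_proof X Y (f : mor (sval X) (sval Y))
    (a : heart_ext_type Y) :
  fmap_full A (cover_fun f) (heart_ext_val a) \in heart_ext_pred X.
Proof.
apply/heart_ext_predP => P g g0; rewrite -fmap_fullM.
have /heart_ext_predP := heart_ext_valP a; apply.
by rewrite cmpA cover_funE -cmpA g0 cmpf0.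
Qed.

Definition heart_ext_map X Y (f : mor (sval X) (sval Y))
    (a : heart_ext_type Y) : heart_ext_type X :=
  HeartExt (heart_ext_map_proof f a).

Lemma heart_ext_mapE X Y (f : mor (sval X) (sval Y)) g (a : heart_ext_type Y) :
  cover_map Y \oc g = f \oc cover_map X ->
  heart_ext_val (heart_ext_map f a) = fmap_full A g (heart_ext_val a).
Proof. by move=> gE; apply: heart_ext_eq; rewrite cover_funE. Qed.

Lemma heart_ext_map_linear X Y (f : mor (sval X) (sval Y)) :
  linear (heart_ext_map f).
Proof. by move=> a x y; apply: val_inj; rewrite /= linearP. Qed.

HB.instance Definition _ X Y (f : mor (sval X) (sval Y)) :=
  GRing.isLinear.Build R (heart_ext_type Y) (heart_ext_type X) *:%R
    (heart_ext_map f) (heart_ext_map_linear f).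

Lemma heart_ext_map1 X (a : heart_ext_type X) :
  heart_ext_map (idm (sval X)) a = a.
Proof.
apply: heart_ext_inj; rewrite (heart_ext_mapE (g := idm _)) ?fmap_full1 //.
by rewrite cmp1f cmpf1.
Qed.

Lemma heart_ext_mapM X Y Z (g : mor (sval Y) (sval Z))
    (f : mor (sval X) (sval Y)) a :
  heart_ext_map (g \oc f) a = heart_ext_map f (heart_ext_map g a).
Proof.
apply: heart_ext_inj.
rewrite (heart_ext_mapE (g := cover_fun g \oc cover_fun f)).
  by rewrite fmap_fullM.
by rewrite cmpA cover_funE -!cmpA cover_funE.
Qed.

Lemma heart_ext_mapP X Y a (f g : mor (sval X) (sval Y))
    (x : heart_ext_type Y) :
  heart_ext_map (a *: f + g) x = a *: heart_ext_map f x + heart_ext_map g x.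
Proof.
apply: heart_ext_inj; rewrite heart_ext_valZD.
rewrite (heart_ext_mapE (g := a *: cover_fun f + cover_fun g)).
  by rewrite fmap_fullP.
by rewrite cmpPr cmpPl !cover_funE.
Qed.

Definition heart_ext : modfun Wge :=
  @ModFun R Wge (fun X => heart_ext_type X) (fun X Y f => heart_ext_map f)
    heart_ext_map1 heart_ext_mapM heart_ext_mapP.

(** A class y on Y that dies on X defines a class on Z because a map from the
    heart to Z composes to zero with Z -> X[1], which lands in weight >= 1; it
    therefore lifts to Y, and two lifts differ by a map through X. *)
Lemma heart_ext_exact X Y Z (u : mor (sval X) (sval Y))
    (v : mor (sval Y) (sval Z))
    (t : mor (sval Z) (sh C (sval X))) (y : heart_ext Y) :
  dist u v t -> fmap_full heart_ext u y = 0 ->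
  exists z : heart_ext Z, y = fmap_full heart_ext v z.
Proof.
move=> uvt uy0.
(* y restricts to zero along every map from the heart that dies in Z, since *)
(* such a map factors through X                                             *)
have y0 P (g : mor (sval P) (sval (cover Y))) :
    v \oc (cover_map Y \oc g) = 0 -> fmap_full A g (heart_ext_val y) = 0.
  move=> vg0; have [x xE] := dist_lift uvt vg0.
  have [x' x'E] := cover_lift x.
  rewrite (@heart_ext_eq Y P g (cover_fun u \oc x')) ?fmap_fullM.
    have := congr1 (@heart_ext_val X) uy0; rewrite /fmap_full /= => ->.
    exact: linear0.
  by rewrite cmpA cover_funE -cmpA x'E.
have yE P (g g' : mor (sval P) (sval (cover Y))) :
    v \oc (cover_map Y \oc g) = v \oc (cover_map Y \oc g') ->
    fmap_full A g (heart_ext_val y) = fmap_full A g' (heart_ext_val y).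
  move=> gg'; apply/eqP; rewrite -subr_eq0 -fmap_fullB; apply/eqP/y0.
  by rewrite !cmpfB gg' subrr.
have [|g gE] := dist_liftS (f := cover_map Z) uvt.
  apply: w_orthz (wdL_le _) (shiftp_sh _); last exact/wge0P/(proj2_sig X).
  by [].
have [g' g'E] := cover_lift (P := cover Z) g.
have zP : fmap_full A g' (heart_ext_val y) \in heart_ext_pred Z.
  apply/heart_ext_predP => P h h0; rewrite -fmap_fullM; apply: y0.
  by rewrite !cmpA -(cmpA v) g'E gE h0.
exists (HeartExt zP); apply: heart_ext_inj; rewrite /fmap_full /= -fmap_fullM.
rewrite -[LHS]fmap_full1; apply: yE.
by rewrite !cmpA -(cmpA v (cover_map Y) g') g'E gE cover_funE cmpf1.
Qed.

Lemma heart_ext_wge1 X : wge w 1 (sval X) -> forall a : heart_ext X, a = 0.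
Proof.
move=> X1 a; apply: heart_ext_inj => /=; rewrite -[LHS]fmap_full1.
have /heart_ext_predP := heart_ext_valP a; apply.
by rewrite cmpf1; apply: w_orthz (wdL_le _) X1.
Qed.

Definition heart_wge P : Wge := exist _ (sval P) (proj2_sig P).2.

Lemma heart_ext_unit_proof P (a : A P) :
  fmap_full A (Y := P) (cover_map (heart_wge P)) a
    \in heart_ext_pred (heart_wge P).
Proof.
by apply/heart_ext_predP => Q g g0; rewrite -fmap_fullM [_ \oc g]g0 fmap_full0.
Qed.

Definition heart_ext_unit P (a : A P) : heart_ext (heart_wge P) :=
  HeartExt (heart_ext_unit_proof a).

Lemma heart_ext_unit_linear P : linear (@heart_ext_unit P).
Proof. by move=> a x y; apply: heart_ext_inj; rewrite /= linearP. Qed.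

Lemma heart_ext_unit_nat P Q (f : mor (sval P) (sval Q)) (a : A Q) :
  heart_ext_unit (fmap_full A f a) =
  fmap_full heart_ext (X := heart_wge P) (Y := heart_wge Q) f
    (heart_ext_unit a).
Proof.
apply: heart_ext_inj; rewrite [LHS]/= /fmap_full [RHS]/= -!fmap_fullM.
by rewrite [cover_map (heart_wge Q) \oc _]cover_funE.
Qed.

Lemma cover_split P : exists s, cover_map (heart_wge P) \oc s = idm (sval P).
Proof. exact: cover_lift. Qed.

Lemma heart_ext_unit_inj P (a : A P) : heart_ext_unit a = 0 -> a = 0.
Proof.
move=> a0; have [s sE] := cover_split P.
rewrite -[a]fmap_full1 -sE fmap_fullM.
by have := congr1 (@heart_ext_val _) a0; rewrite /= => ->; rewrite linear0.
Qed.

Lemma heart_ext_unit_surj P (a : heart_ext (heart_wge P)) :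
  exists b, heart_ext_unit b = a.
Proof.
have [s sE] := cover_split P.
exists (fmap_full A (Y := cover _) s (heart_ext_val a)); apply: heart_ext_inj.
rewrite /= -fmap_fullM -[RHS]fmap_full1; apply: heart_ext_eq.
by rewrite cmpA [_ \oc s]sE cmp1f cmpf1.
Qed.

Lemma heart_ext_fin_gen : noetherian R -> (forall P, fin_gen (A P)) ->
  forall X, fin_gen (heart_ext X).
Proof.
move=> R_noeth fgA X.
pose f (a : heart_ext X) : A (cover X) := heart_ext_val a.
have fL : linear f by [].
pose fl : {linear heart_ext X -> A (cover X)} :=
  HB.pack f (GRing.isLinear.Build R (heart_ext X) (A (cover X)) *:%R f fL).
by apply: (fin_gen_sub (g := fl)) (fgA _) => // x x0; apply: heart_ext_inj.
Qed.

End HeartExtension.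

(** * Extending a left exact functor from weight >= 0 to the whole category *)

Section AisleExtension.
Variables (R : comPzRingType) (C : tricat R) (w : weight_structure C).
Variable D : weight_decs w.
Local Notation Wge := (full_lincat (wge0 w)).
Variable G : modfun Wge.
Implicit Types (X Y Z : Wge) (L M N : C).

Definition hull M : Wge :=
  exist _ (wdR (D (-1) M)) ((wge0P w _).1 (wdR_ge (D (-1) M))).

Definition hull_map M : mor M (sval (hull M)) := wdb (D (-1) M).

Lemma hull_colift_ex M X (f : mor M (sval X)) : exists g, g \oc hull_map M = f.
Proof. by apply: wd_colift; apply/wge0P; exact: proj2_sig X. Qed.

Definition hull_colift M X (f : mor M (sval X)) :=
  projT1 (cid (hull_colift_ex f)).

Lemma hull_coliftE M X (f : mor M (sval X)) : hull_colift f \oc hull_map M = f.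
Proof. exact: projT2 (cid (hull_colift_ex f)). Qed.

(** Morphisms from w_{>= 0} M to weight >= 0 that vanish on M are those that
    factor through (w_{<= -1} M)[1], hence through its own hull: this one map
    accounts for all of them. *)
Definition hull_rel M :
    mor (sval (hull M)) (sval (hull (sh C (wdL (D (-1) M))))) :=
  hull_map _ \oc wdc (D (-1) M).

Lemma hull_relK M : hull_rel M \oc hull_map M = 0.
Proof. by rewrite -cmpA [_ \oc hull_map M]wdcbK cmpf0. Qed.

Lemma hull_rel_factor M X (g : mor (sval (hull M)) (sval X)) :
  g \oc hull_map M = 0 -> exists h, g = h \oc hull_rel M.
Proof.
move=> /(dist_coliftS (wd_dist (D (-1) M)))[h <-].
by exists (hull_colift h); rewrite cmpA hull_coliftE.
Qed.

(** The left Kan extension of G, that is the coend of C(M, X) (x) G(X) over X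
    in w >= 0. Every M has a weakly universal map to w >= 0, so the coend
    reduces to a cokernel. *)
Definition aisle_ext_obj M : lmodType R := coker_mod (fmap_full G (hull_rel M)).

(** The class of f (x) a in the coend. *)
Definition symbol M X (f : mor M (sval X)) (a : G X) : aisle_ext_obj M :=
  coker_pi _ (fmap_full G (hull_colift f) a).

(** Any extension of f to the hull computes the symbol: two of them differ by a
    morphism that factors through the relation map. *)
Lemma symbolE M X (g : mor (sval (hull M)) (sval X)) a :
  symbol (g \oc hull_map M) a = coker_pi _ (fmap_full G g a).
Proof.
apply/eqP; rewrite -subr_eq0 -linearB -fmap_fullB; apply/eqP/coker_pi_eq0.
have [|h ->] := @hull_rel_factor M X (hull_colift (g \oc hull_map M) - g).
  by rewrite cmpBf hull_coliftE subrr.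
by exists (fmap_full G h a); rewrite fmap_fullM.
Qed.

Lemma symbol_hull M a : symbol (hull_map M) a = coker_pi _ a.
Proof. by rewrite -[hull_map M]cmp1f symbolE fmap_full1. Qed.

Lemma symbol_ex M (x : aisle_ext_obj M) : exists a, x = symbol (hull_map M) a.
Proof. by have [a ->] := coker_pi_surj x; exists a; rewrite symbol_hull. Qed.

Lemma symbolZD M X (f : mor M (sval X)) k a b :
  symbol f (k *: a + b) = k *: symbol f a + symbol f b.
Proof. by rewrite /symbol !linearP. Qed.

Lemma symbolP M X k (f g : mor M (sval X)) a :
  symbol (k *: f + g) a = k *: symbol f a + symbol g a.
Proof.
rewrite -[f]hull_coliftE -[g]hull_coliftE -cmpPl !symbolE fmap_fullP.
exact: linearP.
Qed.

Lemma symbol0 M X a : symbol (0 : mor M (sval X)) a = 0.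
Proof. by rewrite -(cmp0f _ (hull_map M)) symbolE fmap_full0 linear0. Qed.

(** The dinaturality relation of the coend. *)
Lemma symbolM M X Y (g : mor (sval X) (sval Y)) (f : mor M (sval X)) a :
  symbol (g \oc f) a = symbol f (fmap_full G g a).
Proof. by rewrite -[f]hull_coliftE cmpA !symbolE fmap_fullM. Qed.

Lemma symbol_hull_eq0 M a :
  symbol (hull_map M) a = 0 <-> exists b, a = fmap_full G (hull_rel M) b.
Proof. by rewrite symbol_hull coker_pi_eq0. Qed.

Definition symbol_rep M (x : aisle_ext_obj M) : G (hull M) :=
  projT1 (cid (symbol_ex x)).

Lemma symbol_repE M (x : aisle_ext_obj M) :
  symbol (hull_map M) (symbol_rep x) = x.
Proof. exact/esym/(projT2 (cid (symbol_ex x))). Qed.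

Definition aisle_ext_map M N (f : mor M N) (x : aisle_ext_obj N) :
    aisle_ext_obj M :=
  symbol (hull_map N \oc f) (symbol_rep x).

Lemma aisle_ext_map_symb M N (f : mor M N) X (g : mor N (sval X)) a :
  aisle_ext_map f (symbol g a) = symbol (g \oc f) a.
Proof.
rewrite -[g]hull_coliftE symbolM -cmpA symbolM /aisle_ext_map.
set b := fmap_full G _ a; apply/eqP; rewrite -subr_eq0; apply/eqP.
have [|c cE] := (symbol_hull_eq0 (symbol_rep (symbol (hull_map N) b) - b)).1.
  by rewrite addrC -scaleN1r symbolZD symbol_repE scaleN1r addNr.
rewrite -[LHS]addrC -scaleN1r -symbolZD scaleN1r addrC cE -symbolM.
by rewrite cmpA hull_relK cmp0f symbol0.
Qed.

Lemma aisle_ext_map_linear M N (f : mor M N) : linear (aisle_ext_map f).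
Proof.
move=> k x y; rewrite -[x in LHS]symbol_repE -[y in LHS]symbol_repE.
by rewrite -symbolZD aisle_ext_map_symb symbolZD.
Qed.

HB.instance Definition _ M N (f : mor M N) :=
  GRing.isLinear.Build R (aisle_ext_obj N) (aisle_ext_obj M) *:%R
    (aisle_ext_map f) (aisle_ext_map_linear f).

Lemma aisle_ext_map1 M (x : aisle_ext_obj M) : aisle_ext_map (idm M) x = x.
Proof. by have [a ->] := symbol_ex x; rewrite aisle_ext_map_symb cmpf1. Qed.

Lemma aisle_ext_mapM L M N (g : mor M N) (f : mor L M) (x : aisle_ext_obj N) :
  aisle_ext_map (g \oc f) x = aisle_ext_map f (aisle_ext_map g x).
Proof. by have [a ->] := symbol_ex x; rewrite !aisle_ext_map_symb cmpA. Qed.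

Lemma aisle_ext_mapP M N k (f g : mor M N) (x : aisle_ext_obj N) :
  aisle_ext_map (k *: f + g) x = k *: aisle_ext_map f x + aisle_ext_map g x.
Proof.
by have [a ->] := symbol_ex x; rewrite !aisle_ext_map_symb cmpPr symbolP.
Qed.

Definition aisle_ext : modfun C :=
  @ModFun R C aisle_ext_obj (fun M N f => aisle_ext_map f)
    aisle_ext_map1 aisle_ext_mapM aisle_ext_mapP.

Lemma symbol_id_ex X (x : aisle_ext (sval X)) :
  exists a, x = symbol (idm (sval X)) a.
Proof.
have [a ->] := symbol_ex x; exists (fmap_full G (hull_map (sval X)) a).
by rewrite -symbolM cmpf1.
Qed.

(** This makes the extension agree with G on w >= 0: there the identity extends
    to the hull, so a relation restricted back along the hull map is zero. *)
Lemma symbol_id_eq0 X (a : G X) : symbol (idm (sval X)) a = 0 -> a = 0.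
Proof.
have rE := hull_coliftE (idm (sval X)); set r := hull_colift _ in rE.
rewrite -rE symbolM => /symbol_hull_eq0[b bE].
rewrite -[a]fmap_full1 -rE fmap_fullM bE.
by rewrite -(@fmap_fullM _ _ _ G X _ _ (hull_rel _)) hull_relK fmap_full0.
Qed.

Lemma aisle_ext_wle M : wle w (-1) M -> forall x : aisle_ext M, x = 0.
Proof.
move=> M1 x; have [a ->] := symbol_ex x.
rewrite (_ : hull_map M = 0) ?symbol0 //.
by apply: w_orthz M1 (wdR_ge _).
Qed.

Lemma biprod_wge0 X Y : exists (Z : Wge)
  (i : mor (sval X) (sval Z)) (j : mor (sval Y) (sval Z))
  (p : mor (sval Z) (sval X)) (q : mor (sval Z) (sval Y)),
  [/\ p \oc i = idm _, q \oc j = idm _, q \oc i = 0 & p \oc j = 0].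
Proof.
have [Z [i [j [p [q [pi qj qi pj e]]]]]] :=
  (tri_additive C).2 (sval X) (sval Y).
have Z0 : wge0 w Z.
  apply: wge0_orth => T f T1.
  have Xf : p \oc f = 0 by move/wge0_orthP: (proj2_sig X); apply.
  have Yf : q \oc f = 0 by move/wge0_orthP: (proj2_sig Y); apply.
  by rewrite -[f]cmp1f -e cmpDf -!cmpA Xf Yf !cmpf0 addr0.
by exists (exist _ Z Z0), i, j, p, q.
Qed.

Hypothesis G_exact : forall X Y Z (u : mor (sval X) (sval Y))
  (v : mor (sval Y) (sval Z)) (t : mor (sval Z) (sh C (sval X))) (y : G Y),
  dist u v t -> fmap_full G u y = 0 -> exists z : G Z, y = fmap_full G v z.

(** A class [m, y] on M that dies on L dies because over hull L the element y
    is pulled back from some b through the relation map. So (y, b) on the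
    direct sum of hull M and the target of that relation dies on hull L, along
    the difference k of the two maps, and exactness of G extends it to z on the
    cone E of k, of weight >= 0. The triangle maps to that of k, and h : N -> E
    gives the class [h, z] which restricts to [m, y], as b only meets the zero
    map. *)
Lemma aisle_ext_cohomological : cohomological aisle_ext.
Proof.
move=> L M N u v t uvt x; split=> [ux0|[z ->]]; last first.
  by rewrite -mmapM (dist_comp0 uvt) mmap0.
have [y xE] := symbol_ex x; rewrite {}xE /= in ux0 *.
have u'E := hull_coliftE (hull_map M \oc u); set u' := hull_colift _ in u'E.
rewrite aisle_ext_map_symb -u'E symbolM in ux0.
have [b bE] := (symbol_hull_eq0 _).1 ux0.
have [B [i [j [p [q [pi qj qi pj]]]]]] :=
  biprod_wge0 (hull M) (hull (sh C (wdL (D (-1) L)))).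
pose k := i \oc u' - j \oc hull_rel L.
have [E [l [r klr]]] := dist_cone k.
have E0 : wge0 w E.
  apply: wge0_orth => T f T1.
  have [|g <-] := dist_liftS (f := f) klr.
    by apply: w_orthz T1 (shiftp_sh _); last exact/wge0P/(proj2_sig (hull L)).
  rewrite (_ : g = 0) ?cmpf0 //.
  by move/wge0_orthP: (proj2_sig B); apply.
pose E' : Wge := exist _ E E0.
have [|h [hv _]] := dist_mor (f := hull_map L) (g := i \oc hull_map M) uvt klr.
  by rewrite /k cmpBf -!(cmpA i) -(cmpA j) u'E hull_relK cmpf0 subr0.
pose yb := fmap_full G p y + fmap_full G q b.
have pk : p \oc k = u' 
  by rewrite cmpfB (cmpA p) (cmpA p) pi pj cmp1f cmp0f subr0.
have qk : q \oc k = - hull_rel L.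
  by rewrite cmpfB (cmpA q) (cmpA q) qi qj cmp1f cmp0f sub0r.
have [z zE] : exists z : G E', yb = fmap_full G (l : mor (sval B) (sval E')) z.
  apply: (@G_exact _ B E' k l r yb klr).
  by rewrite linearD -!fmap_fullM pk qk bE fmap_fullN subrr.
exists (symbol (X := E') h z).
rewrite /= aisle_ext_map_symb hv (symbolM (Y := E') (X := B)) -zE /yb.
rewrite -[fmap_full G p y]scale1r symbolZD scale1r -!symbolM !cmpA pi qi.
by rewrite cmp1f cmp0f symbol0 addr0.
Qed.

Lemma aisle_ext_fin_gen :
  (forall X, fin_gen (G X)) -> forall M, fin_gen (aisle_ext M).
Proof.
move=> fgG M; apply: (fin_gen_surj (f := coker_pi _)) (fgG (hull M)).
exact: coker_pi_surj.
Qed.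

Lemma aisle_ext_wge1 : (forall X, wge w 1 (sval X) -> forall a : G X, a = 0) ->
  forall M, wge w 1 M -> forall x : aisle_ext M, x = 0.
Proof.
move=> G1 M M1 x.
pose X : Wge := exist _ M ((wge0P w M).1 (wge_geS (i := 0) M1)).
have [a ->] := @symbol_id_ex X x.
by rewrite (G1 X M1 a) /symbol !linear0.
Qed.

Lemma aisle_ext_finite_type : w_bounded w ->
  (forall X, fin_gen (G X)) ->
  (forall X, wge w 1 (sval X) -> forall a : G X, a = 0) ->
  finite_type aisle_ext.
Proof.
move=> w_bd fgG G1; split; first exact: aisle_ext_cohomological.
move=> M; split; first exact: aisle_ext_fin_gen.
apply: (vanishing_shifts w_bd (P := fun=> True) (p := -1) (q := 1)) => //.
- by move=> N N1 _; exact: aisle_ext_wle.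
- by move=> N N1 _; exact: aisle_ext_wge1.
- by exists [::].
Qed.

End AisleExtension.

(** * Essential surjectivity and the theorem *)

Section EssentialSurjectivity.
Variables (R : comPzRingType) (C : tricat R) (w : weight_structure C).
Variables (t : t_structure C) (wt : right_adjacent w t).
Hypotheses (C_sat : saturated C) (w_bd : w_bounded w) (R_noeth : noetherian R).

(** The extension H of A to the whole category is of finite type, so some N
    represents it. H vanishes on weight <= -1 and on weight >= 1, which by
    orthogonality puts N in the heart of t; and H restricts to A. *)
Lemma ryoneda_ess_surj
    (fg : forall X N, w_heart w X -> t_heart t N -> fin_gen (mor X N)) :
  ess_surj (ryoneda fg).
Proof.
move=> [A fgA].
have [D _] := weight_dec_choice w.
pose G := heart_ext D A; pose H := aisle_ext D G.
have H_ft : finite_type H.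
  apply: aisle_ext_finite_type => //.
  - exact: heart_ext_exact.
  - exact: heart_ext_fin_gen.
  - exact: heart_ext_wge1.
have [N [p [q [qp pq]]]] := (C_sat H).2 H_ft.
have pK X x : q X (p X x) = x.
  exact: (congr1 (fun s : modnat _ _ => s X x) qp).
have qK X x : p X (q X x) = x.
  exact: (congr1 (fun s : modnat _ _ => s X x) pq).
have Nt : t_heart t N.
  split.
    apply/wt; apply: wge0_orth => T f T1.
    by rewrite -[f]qK (aisle_ext_wle T1 (q T f)) linear0.
  apply: orth_tge0 => // X f X1.
  rewrite -[f]qK (aisle_ext_wge1 (@heart_ext_wge1 _ _ _ _ _) X1 (q X f)).
  exact: linear0.
exists (exist _ N Nt).
pose s (X : full_lincat (w_heart w)) (a : A X) : mor (sval X) N :=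
  p (sval X) (symbol (X := heart_wge X) D (idm (sval X)) (heart_ext_unit D a)).
have sL X : linear (@s X).
  by move=> k a b; rewrite /s heart_ext_unit_linear symbolZD linearP.
pose sl X : {linear A X -> mor (sval X) N} :=
  HB.pack (@s X)
    (GRing.isLinear.Build R (A X) (mor (sval X) N) *:%R (@s X) (sL X)).
have sN (X Y : full_lincat (w_heart w)) (f : mor X Y) (a : A Y) :
    sl X (mmap A f a) = mmap (mrestrict (w_heart w) (yoneda N)) f (sl Y a).
  rewrite /= /s -[RHS](ncomp_nat p).
  rewrite [heart_ext_unit D (mmap A f a)]heart_ext_unit_nat -symbolM cmpf1.
  by congr (p (sval X) _); rewrite [RHS]aisle_ext_map_symb cmp1f.
pose sn := @ModNat R (full_lincat (w_heart w)) A
  (mrestrict (w_heart w) (yoneda N)) sl sN.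
have [||f [g [gf fg']]] := @modnat_iso _ _ _ _ sn.
- move=> X a; rewrite /= /s => /(congr1 (q (sval X))); rewrite pK linear0.
  move/(@symbol_id_eq0 _ _ _ D G (heart_wge X) (heart_ext_unit D a)).
  exact: heart_ext_unit_inj.
- move=> X y.
  have [b bE] := @symbol_id_ex _ _ _ D G (heart_wge X) (q (sval X) y).
  have [a aE] := heart_ext_unit_surj b; exists a.
  by rewrite /= /s aE -bE qK.
by exists g, f.
Qed.

End EssentialSurjectivity.

Theorem proposition3p1p7 (R : comPzRingType) (C : tricat R)
    (w : weight_structure C) (w_bd : w_bounded w) :
  (forall (D : weight_decs w) (H : modfun C) (n : int), finite_type H ->
     finite_type (tau_ge_opp D H n) /\ finite_type (tau_le_opp D H n))
  /\
  (saturated C ->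
     (forall (D : weight_decs w) (i : int) (M : C),
        representable (tau_le_opp D (yoneda M) i) /\
        representable (tau_ge_opp D (yoneda M) i))
     /\
     (exists t : t_structure C, right_adjacent w t)
     /\
     (forall t : t_structure C, right_adjacent w t ->
        exists fg : (forall X N : C, w_heart w X -> t_heart t N ->
                       fin_gen (mor X N)),
          fully_faithful (ryoneda fg) /\
          (noetherian R -> ess_surj (ryoneda fg)))).
Proof.
split=> [D H n H_ft|C_sat].
  by split; [exact: tau_ge_opp_finite_type|exact: tau_le_opp_finite_type].
split=> [D i M|].
  by split; [exact: tau_le_opp_representable|exact: tau_ge_opp_representable].
split=> [|t wt]; first exact: adjacent_t_structure.
have fg X N : w_heart w X -> t_heart t N -> fin_gen (mor X N).
  by move=> _ _; have [_ /(_ X)[]] := (C_sat _).1 (yoneda_representable N).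
exists fg; split; first exact: ryoneda_fully_faithful.
by move=> R_noeth; exact: ryoneda_ess_surj.
Qed.
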